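(* Let $V$ be a finite-dimensional real vector space. (i) The function $\Delta:\mathcal{C}(V)\to K(V)\otimes_{\mathbb{Z}}K(V)$, \[\Delta(K)=\sum_{F\in\mathcal{F}(K)}(-1)^{\dim F}[F]\otimes[\langle F\rangle+K],\] is a valuation, and the induced homomorphism $\Delta:K(V)\to K(V)\otimes_{\mathbb{Z}}K(V)$ is coassociative: $(\Delta\otimes\mathrm{id})\circ\Delta=(\mathrm{id}\otimes\Delta)\circ\Delta$. (ii) The function $\varepsilon:\mathcal{C}(V)\to\mathbb{Z}$ with $\varepsilon(K)=(-1)^{\dim K}$ if $K$ is a vector subspace of $V$ and $\varepsilon(K)=0$ otherwise is a valuation, and the induced homomorphism $\varepsilon:K(V)\to\mathbb{Z}$ is a counit for $\Delta$: $(\varepsilon\otimes\mathrm{id})\circ\Delta=\mathrm{id}=(\mathrm{id}\otimes\varepsilon)\circ\Delta$.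
   Context: A closed convex polyhedral cone in $V$ is a set $\mathbb{R}_{\ge0}v_1+\dots+\mathbb{R}_{\ge0}v_k$ ($k\ge0$, $v_i\in V$); $\mathcal{C}(V)$ is the set of them. $\mathcal{F}(K)$ is the set of closed faces of $K$ (including $K$); $\dim$ is the dimension of the linear span; $\langle F\rangle$ is the linear span of $F$. $K(V)$ is the free abelian group on $\mathcal{C}(V)$ modulo the relations $[K\cup K']+[K\cap K']=[K]+[K']$ for $K,K'\in\mathcal{C}(V)$ with $K\cup K'\in\mathcal{C}(V)$. A valuation on $\mathcal{C}(V)$ with values in an abelian group $A$ is a function $f$ with $f(K\cup K')+f(K\cap K')=f(K)+f(K')$ whenever $K,K',K\cup K'\in\mathcal{C}(V)$; equivalently it induces a homomorphism $K(V)\to A$ with $[K]\mapsto f(K)$. *)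

(* Defs.v *)
From mathcomp.multinomials Require Import freeg.
From HB Require Import structures.
From mathcomp Require Import all_boot all_order all_algebra.
From mathcomp Require Import boolp classical_sets functions cardinality fsbigop.
From mathcomp Require Import reals.

Set Implicit Arguments.
Unset Strict Implicit.
Unset Printing Implicit Defensive.

Import Order.TTheory GRing.Theory Num.Theory.
Local Open Scope ring_scope.
Local Open Scope quotient_scope.
Local Open Scope classical_set_scope.

Reserved Notation "a *t b" (at level 40, left associativity).

Section Presented.
Variables (T : choiceType) (S : set {freeg T / int}).

Definition fgen (t : T) : {freeg T / int} := Freeg [:: (1, t)].

Definition rel_span : {pred {freeg T / int}} :=
  fun x => `[< forall I : zmodClosed {freeg T / int},
               (forall r, S r -> r \in I) -> x \in I >].

Lemma rel_spanP : zmod_closed rel_span.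
Proof.
split=> [|x y /asboolP hx /asboolP hy]; apply/asboolP => I hI.
  exact: rpred0.
by rewrite rpredB ?hx ?hy.
Qed.

HB.instance Definition _ := GRing.isZmodClosed.Build _ rel_span rel_spanP.

Lemma rel_span_gen r : S r -> r \in rel_span.
Proof. by move=> Sr; apply/asboolP => I; apply. Qed.

Definition presented := Quotient.quot rel_span.

HB.instance Definition _ := GRing.Zmodule.on presented.

Definition pgen (t : T) : presented := \pi_presented (fgen t).

End Presented.

Section FreeLift.
Variables (T : choiceType) (A : zmodType) (f : T -> A).

(* fglift wants a module over the coefficient ring; zmodule A is A as a
   module over int. *)
Definition flift (x : {freeg T / int}) : A := fglift (f : T -> zmodule A) x.

Lemma flift_is_additive : zmod_morphism flift.
Proof. exact: (@lift_is_additive int T (zmodule A)). Qed.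

HB.instance Definition _ :=
  GRing.isZmodMorphism.Build _ _ flift flift_is_additive.

Lemma flift_gen t : flift (fgen t) = f t.
Proof. by rewrite /flift /fgen liftU scale1r. Qed.

End FreeLift.

Lemma freeg_gen_ind (T : choiceType) (P : {freeg T / int} -> Prop) :
  (forall t, P (fgen t)) -> (forall x y, P x -> P y -> P (x - y)) ->
  P 0 -> forall x, P x.
Proof.
move=> Pg PB P0 x.
have PN y : P y -> P (- y) by move=> Py; rewrite -sub0r; apply: PB.
have PD y z : P y -> P z -> P (y + z).
  by move=> Py Pz; rewrite -[z]opprK; apply: PB => //; apply: PN.
have PM y n : P y -> P (y *+ n).
  by move=> Py; elim: n => [|n IHn]; rewrite ?mulr0n ?mulrS //; apply: PD.
rewrite -[x]freeg_sumE; elim/big_ind: _ => // t _.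
rewrite -[coeff _ _]intz -freeg_mulz.
by case: (coeff _ _) => n; rewrite ?NegzE ?mulrNz; try apply: PN; apply: PM;
  apply: Pg.
Qed.

Section PresentedLift.
Variables (T : choiceType) (S : set {freeg T / int}) (A : zmodType).

Definition kills (f : T -> A) := forall r, S r -> flift f r = 0.

(* The homomorphism on the quotient induced by f; the proof that the relators
   are killed is an argument so that additivity can be inferred. *)
Definition plift (f : T -> A) (hf : kills f) (x : presented S) : A :=
  flift f (repr x).

Lemma kills_span f x : kills f -> x \in rel_span S -> flift f x = 0.
Proof.
move=> hf /asboolP hx.
pose I : {pred {freeg T / int}} := fun y => flift f y == 0.
have zI : zmod_closed I.
  split=> [|y z]; rewrite /in_mem /= /I ?raddf0 // => /eqP hy /eqP hz.
  by rewrite raddfB /= hy hz subrr.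
pose Im := GRing.isZmodClosed.Build _ I zI.
pose IZ : zmodClosed _ := HB.pack I Im.
by have /(_ _)/eqP := hx IZ; apply=> r Sr; apply/eqP/hf.
Qed.

Lemma plift_pi f (hf : kills f) y : plift hf (\pi_(presented S) y) = flift f y.
Proof.
apply/eqP; rewrite /plift -subr_eq0 -raddfB /=; apply/eqP/kills_span => //.
by rewrite Quotient.idealrBE reprK.
Qed.

Lemma plift_is_additive f (hf : kills f) : zmod_morphism (plift hf).
Proof.
move=> x y; rewrite -[x]reprK -[y]reprK -(raddfB (\pi_(presented S))) /=.
by rewrite !plift_pi raddfB.
Qed.

HB.instance Definition _ f (hf : kills f) :=
  GRing.isZmodMorphism.Build _ _ (plift hf) (plift_is_additive hf).

Lemma plift_gen f (hf : kills f) t : plift hf (pgen S t) = f t.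
Proof. by rewrite plift_pi flift_gen. Qed.

Lemma presented_ext (g h : {additive presented S -> A}) :
  (forall t, g (pgen S t) = h (pgen S t)) -> g =1 h.
Proof.
move=> gh x; rewrite -[x]reprK; move: (repr x) => {}x.
elim/freeg_gen_ind: x => [//|x y|]; last by rewrite !raddf0.
by rewrite !raddfB /= => -> ->.
Qed.

End PresentedLift.

Lemma pi_relator (T : choiceType) (S : set {freeg T / int}) r :
  S r -> \pi_(presented S) r = 0.
Proof.
move=> Sr; rewrite -(raddf0 (\pi_(presented S))); apply/eqP.
by rewrite -Quotient.idealrBE subr0 rel_span_gen.
Qed.

Section Tensor.
Variables A B : zmodType.

Definition tensor_rel : set {freeg (A * B)%type / int} :=
  [set r | (exists a a' b,
              r = fgen (a + a', b) - fgen (a, b) - fgen (a', b)) \/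
           (exists a b b',
              r = fgen (a, b + b') - fgen (a, b) - fgen (a, b'))].

Definition tensor := presented tensor_rel.

HB.instance Definition _ := GRing.Zmodule.on tensor.

Definition tpure (a : A) (b : B) : tensor := pgen tensor_rel (a, b).

End Tensor.

Notation "a *t b" := (tpure a b) : ring_scope.

Lemma tpureDl (A B : zmodType) (a a' : A) (b : B) :
  (a + a') *t b = a *t b + a' *t b.
Proof.
apply/eqP; rewrite -subr_eq0 opprD addrA /tpure /pgen -!raddfB /=.
by apply/eqP/pi_relator; left; exists a, a', b.
Qed.

Lemma tpureDr (A B : zmodType) (a : A) (b b' : B) :
  a *t (b + b') = a *t b + a *t b'.
Proof.
apply/eqP; rewrite -subr_eq0 opprD addrA /tpure /pgen -!raddfB /=.
by apply/eqP/pi_relator; right; exists a, b, b'.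
Qed.

Lemma tensor_ind (A B : zmodType) (P : tensor A B -> Prop) :
  (forall a b, P (a *t b)) -> (forall x y, P x -> P y -> P (x - y)) ->
  P 0 -> forall x, P x.
Proof.
move=> Pp PB P0 x; rewrite -[x]reprK; move: (repr x) => {}x.
elim/freeg_gen_ind: x => [[a b]|x y Px Py|]; rewrite ?raddfB ?raddf0 //.
- exact: Pp.
- exact: PB.
Qed.

Lemma tpureBl (A B : zmodType) (a a' : A) (b : B) :
  (a - a') *t b = a *t b - a' *t b.
Proof. by apply/eqP; rewrite eq_sym subr_eq -tpureDl subrK. Qed.

Lemma tpureBr (A B : zmodType) (a : A) (b b' : B) :
  a *t (b - b') = a *t b - a *t b'.
Proof. by apply/eqP; rewrite eq_sym subr_eq -tpureDr subrK. Qed.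

Lemma tpure0l (A B : zmodType) (b : B) : (0 : A) *t b = 0.
Proof. by rewrite -{1}[0](subrr 0) tpureBl subrr. Qed.

Lemma tpure0r (A B : zmodType) (a : A) : a *t (0 : B) = 0.
Proof. by rewrite -{1}[0](subrr 0) tpureBr subrr. Qed.

Section TensorLift.
Variables A B C : zmodType.

Definition biadditive (f : A -> B -> C) :=
  (forall a a' b, f (a + a') b = f a b + f a' b) /\
  (forall a b b', f a (b + b') = f a b + f a b').

Lemma biadditive_kills f :
  biadditive f -> kills (@tensor_rel A B) (fun ab => f ab.1 ab.2).
Proof.
case=> fl fr r [[a [a' [b ->]]]|[a [b [b' ->]]]];
  by rewrite !raddfB /= !flift_gen /= ?fl ?fr addrAC addrK subrr.
Qed.

Definition tlift f (hf : biadditive f) : tensor A B -> C :=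
  plift (biadditive_kills hf).

HB.instance Definition _ f (hf : biadditive f) :=
  GRing.Additive.on (tlift hf).

Lemma tlift_pure f (hf : biadditive f) a b : tlift hf (a *t b) = f a b.
Proof. by rewrite /tlift /tpure plift_gen. Qed.

Lemma tensor_ext (g h : {additive tensor A B -> C}) :
  (forall a b, g (a *t b) = h (a *t b)) -> g =1 h.
Proof. by move=> gh; apply: presented_ext => -[a b]; apply: gh. Qed.

End TensorLift.

Section TensorMap.
Variables A B A' B' : zmodType.
Variables (f : {additive A -> A'}) (g : {additive B -> B'}).

Lemma tmap_biadditive : biadditive (fun a b => f a *t g b).
Proof. by split=> *; rewrite raddfD /= ?tpureDl ?tpureDr. Qed.

Definition tmap : tensor A B -> tensor A' B' := tlift tmap_biadditive.

HB.instance Definition _ := GRing.Additive.on tmap.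

Lemma tmap_pure a b : tmap (a *t b) = f a *t g b.
Proof. exact: tlift_pure. Qed.

End TensorMap.

Section TensorAssoc.
Variables A B C : zmodType.

Lemma tassoc_in_biadditive (c : C) :
  biadditive (fun (a : A) (b : B) => a *t (b *t c)).
Proof. by split=> *; rewrite ?tpureDl ?tpureDr. Qed.

Lemma tassoc_biadditive :
  biadditive (fun (x : tensor A B) c => tlift (tassoc_in_biadditive c) x).
Proof.
split=> [x x' c|x c c']; first by rewrite raddfD.
pose h : tensor A B -> tensor A (tensor B C) :=
  tlift (tassoc_in_biadditive c) \+ tlift (tassoc_in_biadditive c').
rewrite -[RHS]/(h x); apply: tensor_ext x => a b /=.
by rewrite /h /= !tlift_pure !tpureDr.
Qed.

(* Bijective by tassocK and tassocVK below. *)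
Definition tassoc : tensor (tensor A B) C -> tensor A (tensor B C) :=
  tlift tassoc_biadditive.

HB.instance Definition _ := GRing.Additive.on tassoc.

Lemma tassoc_pure a b c : tassoc (a *t b *t c) = a *t (b *t c).
Proof. by rewrite /tassoc !tlift_pure. Qed.

Lemma tassocV_in_biadditive (a : A) :
  biadditive (fun (b : B) (c : C) => a *t b *t c).
Proof. by split=> *; rewrite ?(tpureDl, tpureDr). Qed.

Lemma tassocV_biadditive :
  biadditive (fun a (x : tensor B C) => tlift (tassocV_in_biadditive a) x).
Proof.
split=> [a a' x|a x x']; last by rewrite raddfD.
pose h : tensor B C -> tensor (tensor A B) C :=
  tlift (tassocV_in_biadditive a) \+ tlift (tassocV_in_biadditive a').
rewrite -[RHS]/(h x); apply: tensor_ext x => b c /=.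
by rewrite /h /= !tlift_pure !tpureDl.
Qed.

Definition tassocV : tensor A (tensor B C) -> tensor (tensor A B) C :=
  tlift tassocV_biadditive.

HB.instance Definition _ := GRing.Additive.on tassocV.

Lemma tassocV_pure a b c : tassocV (a *t (b *t c)) = a *t b *t c.
Proof. by rewrite /tassocV !tlift_pure. Qed.

Lemma tassocK : cancel tassoc tassocV.
Proof.
elim/tensor_ind => [x c|x y hx hy|]; last 2 first.
- by rewrite !raddfB /= hx hy.
- by rewrite !raddf0.
elim/tensor_ind: x => [a b|x y hx hy|].
- by rewrite tassoc_pure tassocV_pure.
- by rewrite tpureBl !raddfB /= hx hy.
- by rewrite tpure0l !raddf0.
Qed.

Lemma tassocVK : cancel tassocV tassoc.
Proof.
elim/tensor_ind => [a x|x y hx hy|]; last 2 first.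
- by rewrite !raddfB /= hx hy.
- by rewrite !raddf0.
elim/tensor_ind: x => [b c|x y hx hy|].
- by rewrite tassocV_pure tassoc_pure.
- by rewrite tpureBr !raddfB /= hx hy.
- by rewrite tpure0r !raddf0.
Qed.

End TensorAssoc.

Section TensorUnit.
Variable A : zmodType.

Lemma tunitl_biadditive : biadditive (fun (n : int) (a : A) => a *~ n).
Proof. by split=> *; rewrite ?mulrzDr ?mulrzDl. Qed.

(* Bijective by tunitl_pure and tunitlK; similarly for tunitr. *)
Definition tunitl : tensor int A -> A := tlift tunitl_biadditive.

HB.instance Definition _ := GRing.Additive.on tunitl.

Lemma tunitl_pure n a : tunitl (n *t a) = a *~ n.
Proof. exact: tlift_pure. Qed.

Lemma tunitr_biadditive : biadditive (fun (a : A) (n : int) => a *~ n).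
Proof. by split=> *; rewrite ?mulrzDr ?mulrzDl. Qed.

Definition tunitr : tensor A int -> A := tlift tunitr_biadditive.

HB.instance Definition _ := GRing.Additive.on tunitr.

Lemma tunitr_pure a n : tunitr (a *t n) = a *~ n.
Proof. exact: tlift_pure. Qed.

Lemma tpure_mulz_l (B : zmodType) (a : A) (b : B) n :
  (a *~ n) *t b = (a *t b) *~ n.
Proof.
have gA : zmod_morphism (fun a : A => a *t b) by move=> x y; rewrite tpureBl.
pose g : {additive A -> tensor A B} :=
  HB.pack (fun a : A => a *t b) (GRing.isZmodMorphism.Build _ _ _ gA).
exact: (raddfMz g).
Qed.

Lemma tpure_mulz_r (B : zmodType) (a : A) (b : B) n :
  a *t (b *~ n) = (a *t b) *~ n.
Proof.
have gA : zmod_morphism (fun b : B => a *t b) by move=> x y; rewrite tpureBr.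
pose g : {additive B -> tensor A B} :=
  HB.pack (fun b : B => a *t b) (GRing.isZmodMorphism.Build _ _ _ gA).
exact: (raddfMz g).
Qed.

End TensorUnit.

Lemma tunitlK (A : zmodType) : cancel (@tunitl A) (tpure 1).
Proof.
elim/tensor_ind => [n a|x y hx hy|].
- by rewrite tunitl_pure tpure_mulz_r -tpure_mulz_l intz.
- by rewrite raddfB /= tpureBr hx hy.
- by rewrite raddf0 tpure0r.
Qed.

Lemma tunitrK (A : zmodType) : cancel (@tunitr A) (fun a => a *t 1).
Proof.
elim/tensor_ind => [a n|x y hx hy|].
- by rewrite tunitr_pure tpure_mulz_l -tpure_mulz_r intz.
- by rewrite raddfB /= tpureBl hx hy.
- by rewrite raddf0 tpure0l.
Qed.

Section ConicHull.
Variables (R : realType) (E : lmodType R).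
Implicit Types (s : seq E) (P : set E).

Definition conic_hull s : set E :=
  [set x | exists2 c : nat -> R,
     forall i, 0 <= c i & x = \sum_(i < size s) c i *: s`_i].

Definition convex_cone P :=
  [/\ P 0, forall x y, P x -> P y -> P (x + y) &
      forall (a : R) x, 0 <= a -> P x -> P (a *: x)].

Lemma conic_hull_convex s : convex_cone (conic_hull s).
Proof.
split.
- exists (fun=> 0) => //; rewrite big1 // => i _; exact: scale0r.
- move=> _ _ [c c0 ->] [d d0 ->]; exists (fun i => c i + d i).
    by move=> i; rewrite addr_ge0.
  by rewrite -big_split; apply: eq_bigr => i _; rewrite scalerDl.
- move=> a _ a0 [c c0 ->]; exists (fun i => a * c i).
    by move=> i; rewrite mulr_ge0.
  by rewrite scaler_sumr; apply: eq_bigr => i _; rewrite scalerA.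
Qed.

Lemma conic_hull_gen s v : v \in s -> conic_hull s v.
Proof.
move=> vs; exists (fun i => (i == index v s)%:R); first by move=> i; case: eqP.
have hi : (index v s < size s)%N by rewrite index_mem.
rewrite (bigD1 (Ordinal hi)) //= eqxx scale1r nth_index // big1 ?addr0 // => i.
by move=> /eqP ne; case: eqP => [e|_]; rewrite ?scale0r //; case: ne; apply/val_inj.
Qed.

Lemma conic_hull_min s P :
  convex_cone P -> (forall v, v \in s -> P v) -> conic_hull s `<=` P.
Proof.
move=> [P0 PD PZ] Ps _ [c c0 ->]; elim/big_ind: _ => // i _.
by apply/PZ/Ps => //; apply: mem_nth.
Qed.

Lemma conic_hullS s s' : {subset s <= s'} -> conic_hull s `<=` conic_hull s'.
Proof.
move=> ss'; apply: conic_hull_min (conic_hull_convex _) _ => v /ss'.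
exact: conic_hull_gen.
Qed.

Lemma conic_hull_cat s s' :
  conic_hull (s ++ s') =
  [set z | exists x y, [/\ conic_hull s x, conic_hull s' y & z = x + y]].
Proof.
have [c0 cD cZ] := conic_hull_convex s.
have [d0 dD dZ] := conic_hull_convex s'.
apply/seteqP; split=> [|_ [x [y [hx hy ->]]]].
  apply: conic_hull_min => [|v].
    split.
    - by exists 0, 0; rewrite addr0.
    - move=> _ _ [x [y [hx hy ->]]] [x' [y' [hx' hy' ->]]].
      by exists (x + x'), (y + y'); split; [apply: cD|apply: dD|rewrite addrACA].
    - move=> a _ a0 [x [y [hx hy ->]]].
      exists (a *: x), (a *: y); split; [exact: cZ|exact: dZ|exact: scalerDr].
  rewrite mem_cat => /orP[] /conic_hull_gen hv.
    by exists v, 0; rewrite addr0.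
  by exists 0, v; rewrite add0r.
have [_ hD _] := conic_hull_convex (s ++ s').
apply: hD.
  by apply: conic_hullS hx => v hv; rewrite mem_cat hv.
by apply: conic_hullS hy => v hv; rewrite mem_cat hv orbT.
Qed.

Lemma conic_hull_halfspace (f : {scalar E}) s :
  exists s', conic_hull s' = conic_hull s `&` [set x | 0 <= f x].
Proof.
pose sp := [seq v <- s | 0 <= f v]; pose sn := [seq v <- s | f v < 0].
pose s' := sp ++ [seq f v *: w - f w *: v | v <- sp, w <- sn].
have [h0 hD hZ] := conic_hull_convex s.
have [h'0 h'D h'Z] := conic_hull_convex s'.
exists s'; apply/seteqP; split.
  apply: conic_hull_min => [|v].
    split.
    - by split=> //=; rewrite linear0.
    - move=> x y [hx fx] [hy fy]; split; first exact: hD.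
      by rewrite /= linearD addr_ge0.
    - move=> a x a0 [hx fx]; split; first exact: hZ.
      by rewrite /= linearZ mulr_ge0.
  rewrite mem_cat => /orP[|/allpairsP[[x y] /= []]].
    by rewrite mem_filter => /andP[fv vs]; split=> //; apply: conic_hull_gen.
  rewrite !mem_filter => /andP[fx xs] /andP[fy ys] ->; split.
    apply: hD; first by apply: hZ => //; apply: conic_hull_gen.
    rewrite -scaleNr; apply: hZ; first by rewrite oppr_ge0 ltW.
    exact: conic_hull_gen.
  by rewrite /= linearB !linearZ /= mulrC subrr.
have neg0 y : conic_hull sn y -> y = 0 \/ f y < 0.
  move: y; apply: conic_hull_min => [|v]; last first.
    by rewrite mem_filter => /andP[fv _]; right.
  split; first by left.
  - move=> x y [->|fx] [->|fy]; rewrite ?addr0 ?add0r; try by [left|right].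
    by right; rewrite linearD; have := addr_gt0 (_ : 0 < - f x) (_ : 0 < - f y);
      rewrite !oppr_gt0 -opprD oppr_gt0; apply.
  - move=> a x; rewrite le_eqVlt => /orP[/eqP<- _|a0].
      by left; rewrite scale0r.
    case=> [->|fx]; first by left; rewrite scaler0.
    by right; rewrite linearZ /= pmulr_rlt0.
have mix x y : conic_hull sp x -> conic_hull sn y ->
    conic_hull s' (f x *: y - f y *: x).
  move=> hx hy; apply: (conic_hull_min (P := [set x |
    conic_hull s' (f x *: y - f y *: x)]) _ _ hx) => [|v vsp] /=.
    split=> /=.
    - by rewrite [f 0]linear0 scale0r scaler0 subrr.
    - move=> u v /h'D hu /hu; rewrite [f (_ + _)]linearD scalerDl scalerDr opprD.
      by rewrite addrACA.
    - move=> a u a0 /(h'Z _ _ a0); congr (conic_hull s' _).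
      by rewrite [f (_ *: _)]linearZ scalerBr !scalerA [a * f y]mulrC.
  apply: (conic_hull_min (P := [set y |
    conic_hull s' (f v *: y - f y *: v)]) _ _ hy) => [|w wsn] /=.
    split=> /=.
    - by rewrite [f 0]linear0 scale0r scaler0 subrr.
    - move=> u w /h'D hu /hu; rewrite [f (_ + _)]linearD scalerDl scalerDr opprD.
      by rewrite addrACA.
    - move=> a u a0 /(h'Z _ _ a0); congr (conic_hull s' _).
      by rewrite [f (_ *: _)]linearZ scalerBr !scalerA [a * f v]mulrC.
  apply: conic_hull_gen; rewrite mem_cat; apply/orP; right.
  by apply/allpairsP; exists (v, w).
have sps' : conic_hull sp `<=` conic_hull s'.
  by apply: conic_hullS => v hv; rewrite mem_cat hv.
have fpos x : conic_hull sp x -> 0 <= f x.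
  move: x; apply: conic_hull_min => [|v]; last by rewrite mem_filter => /andP[].
  split=> /= [|x y hx hy|a x a0 hx]; rewrite ?linear0 ?linearD ?linearZ //=.
    exact: addr_ge0.
  exact: mulr_ge0.
have sE : conic_hull s `<=` conic_hull (sp ++ sn).
  apply: conic_hullS => v vs; rewrite mem_cat !mem_filter vs !andbT.
  by case: ltP.
move=> z [/sE]; rewrite conic_hull_cat => -[x [y [hx hy ->]]] /=.
rewrite linearD => fxy; have fx := fpos _ hx.
have [->|fy] := neg0 _ hy; first by rewrite addr0; apply: sps'.
have {}fx : 0 < f x.
  by rewrite lt_neqAle fx andbT; apply/eqP => e; move: fxy; rewrite -e add0r leNgt fy.
have fx0 : f x != 0 by rewrite gt_eqF.
have -> : x + y = ((f x + f y) / f x) *: x + (f x)^-1 *: (f x *: y - f y *: x).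
  rewrite scalerBr !scalerA mulVf // scale1r mulrDl divff // scalerDl scale1r.
  by rewrite -addrA [y - _]addrC (mulrC (f y)) addNKr.
apply: h'D; first by apply: h'Z; [rewrite divr_ge0 // ltW|apply: sps'].
by apply: h'Z; [rewrite invr_ge0 ltW|apply: mix].
Qed.

Lemma conic_hull_kernels (I : eqType) (f : I -> {scalar E}) (r : seq I) s :
  exists s', conic_hull s' =
    conic_hull s `&` [set x | forall i, i \in r -> f i x = 0].
Proof.
elim: r => [|i r [s1 e1]].
  by exists s; apply/seteqP; split=> [x hx|x [hx _]].
have [s2 e2] := conic_hull_halfspace (f i) s1.
have [s3 e3] := conic_hull_halfspace (\- f i)%R s2.
exists s3; rewrite e3 e2 e1; apply/seteqP; split=> x /=.
  case=> [[[hx hr] f1] f2]; split=> // j; rewrite inE => /predU1P[->|/hr//].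
  by apply/eqP; rewrite eq_le f1 andbT -oppr_ge0.
move=> [hx h]; have fx : f i x = 0 by apply: h; rewrite mem_head.
split; last by rewrite fx oppr0.
split; last by rewrite fx.
by split=> // j hj; apply: h; rewrite inE hj orbT.
Qed.

End ConicHull.

Lemma conic_hull_image (R : realType) (E E' : lmodType R)
    (g : {linear E -> E'}) s :
  conic_hull (map g s) = g @` conic_hull s.
Proof.
apply/seteqP; split=> [|_ [_ [c c0 ->] <-]].
  have [h0 hD hZ] := conic_hull_convex s.
  apply: conic_hull_min => [|_ /mapP[v vs ->]].
    split.
    - by exists 0; rewrite ?linear0.
    - move=> _ _ [x hx <-] [y hy <-].
      by exists (x + y); rewrite ?linearD //; apply: hD.
    - move=> a _ a0 [x hx <-].
      by exists (a *: x); rewrite ?linearZ //; apply: hZ.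
  by exists v => //; apply: conic_hull_gen.
exists c => //; rewrite linear_sum size_map; apply: eq_bigr => i _.
by rewrite linearZ (nth_map 0).
Qed.

Section Cone.
Variables (R : realType) (V : vectType R).

(* A cone is the underlying set: two cones are equal as soon as their sets
   are (cone_inj). *)
Record cone := Cone {
  cone_set :> set V;
  coneP : exists s : seq V, cone_set = conic_hull s
}.

HB.instance Definition _ := gen_eqMixin cone.
HB.instance Definition _ := gen_choiceMixin cone.

Implicit Types K F L : cone.

Lemma cone_inj : injective cone_set.
Proof.
case=> A hA [B hB] /= AB; move: hA hB; rewrite AB => hA hB.
by congr Cone; apply: Prop_irrelevance.
Qed.

Definition cone_gens K : seq V := projT1 (cid (coneP K)).

Lemma cone_gensP K : K = conic_hull (cone_gens K) :> set V.
Proof. by rewrite /cone_gens; case: cid. Qed.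

Lemma cone_convex K : convex_cone K.
Proof. by rewrite cone_gensP; apply: conic_hull_convex. Qed.

Definition cone_span K : {vspace V} := span (cone_gens K).

(* cone_span K is the least subspace containing K, whatever the generators. *)
Lemma cone_spanP K (U : {vspace V}) :
  (cone_span K <= U)%VS <-> (forall x, cone_set K x -> x \in U).
Proof.
split=> [sKU x|KU].
  rewrite cone_gensP => -[c _ ->]; apply: memv_suml => i _; apply: memvZ.
  by apply: (subvP sKU); apply/memv_span/mem_nth.
by apply/span_subvP => v hv; apply: KU; rewrite cone_gensP; apply: conic_hull_gen.
Qed.

Definition cone_dim K : nat := \dim (cone_span K).

Lemma cone_capP K K' :
  exists s, (K : set V) `&` (K' : set V) = conic_hull s.
Proof.
pose inl (v : V) : (V * V)%type := (v, 0).
pose inr (v : V) : (V * V)%type := (0, v).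
have linl : linear inl.
  by move=> a x y; rewrite /inl; congr pair; rewrite /= scaler0 addr0.
have linr : linear inr.
  by move=> a x y; rewrite /inr; congr pair; rewrite /= scaler0 addr0.
pose il : {linear V -> (V * V)%type} :=
  HB.pack inl (GRing.isLinear.Build _ _ _ _ inl linl).
pose ir : {linear V -> (V * V)%type} :=
  HB.pack inr (GRing.isLinear.Build _ _ _ _ inr linr).
pose g i (p : (V * V)%type) : R :=
  coord (vbasis fullv) i p.1 - coord (vbasis fullv) i p.2.
have lg i : scalar (g i).
  move=> a [x x'] [y y']; rewrite /g /= !linearP /= opprD addrACA.
  by rewrite mulrBr.
pose gl i : {scalar (V * V)%type} :=
  HB.pack (g i) (GRing.isLinear.Build _ _ _ _ (g i) (lg i)).
pose s := map il (cone_gens K) ++ map ir (cone_gens K').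
have [t et] := conic_hull_kernels gl (enum 'I_(\dim {:V})) s.
exists (map fst t); rewrite (conic_hull_image (E := (V * V)%type) fst).
rewrite et conic_hull_cat !conic_hull_image -!cone_gensP.
apply/seteqP; split=> [x [Kx K'x]|x].
  exists (x, x) => //; split=> /=; last first.
    by move=> i _; rewrite /gl /= /g subrr.
  exists (x, 0), (0, x); split; [by exists x|by exists x|].
  by congr pair; rewrite /= ?addr0 ?add0r.
move=> [_ [[_ [_ [[y Ky <-] [z K'z <-] ->]]]]] /= h <-.
have -> : (y + 0)%R = y by rewrite addr0.
suff e : y = z by split=> //; rewrite e.
rewrite (coord_vbasis (memvf y)) (coord_vbasis (memvf z)).
apply: eq_bigr => i _; congr (_ *: _); apply/eqP; rewrite -subr_eq0.
by have := h i (mem_enum _ i); rewrite /g /= add0r addr0 => ->.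
Qed.

Definition cone_cap K K' : cone :=
  @Cone ((K : set V) `&` (K' : set V)) (cone_capP K K').

Lemma cone_addP K K' :
  exists s, [set z | exists x y,
    [/\ cone_set K x, cone_set K' y & z = x + y]] = conic_hull s.
Proof.
exists (cone_gens K ++ cone_gens K').
by rewrite conic_hull_cat -!cone_gensP.
Qed.

Definition cone_add K K' : cone := Cone (cone_addP K K').

Lemma vs_coneP (U : {vspace V}) :
  exists s, [set x | x \in U] = conic_hull s.
Proof.
exists (vbasis U ++ map -%R (vbasis U)); apply/seteqP; split=> x /=.
  move=> /coord_vbasis ->.
  have [h0 hD hZ] := conic_hull_convex (vbasis U ++ map -%R (vbasis U)).
  elim/big_ind: _ => // i _; have := mem_nth 0 (_ : i < size (vbasis U))%N.
  rewrite size_tuple => /(_ (ltn_ord i)) hi.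
  case: (lerP 0 (coord (vbasis U) i x)) => hc.
    by apply: hZ => //; apply: conic_hull_gen; rewrite mem_cat hi.
  rewrite -[_ *: _]opprK -scaleNr -scalerN; apply: hZ.
    by rewrite oppr_ge0 ltW.
  by apply: conic_hull_gen; rewrite mem_cat map_f ?orbT.
move: x; apply: conic_hull_min => [|v].
  split=> /= [|x y|a x _]; [exact: mem0v|exact: memvD|exact: memvZ].
rewrite mem_cat => /orP[/vbasis_mem//|/mapP[w /vbasis_mem wU ->]] /=.
by rewrite memvN.
Qed.

Definition vs_cone (U : {vspace V}) : cone := Cone (vs_coneP U).

Definition is_subspace K := exists U : {vspace V}, K = vs_cone U.

(* Faces are cut out by linear forms that are nonnegative on K; f = 0 gives K
   itself. Ranging over cones F loses nothing: by face_gens, such a set is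
   always finitely generated. *)
Definition faces K : set cone :=
  [set F | exists f : 'Hom(V, R^o),
     (forall x, cone_set K x -> 0 <= f x) /\
     (F = K `&` [set x | f x = 0] :> set V)].

Lemma face_gens K (f : 'Hom(V, R^o)) : (forall x, cone_set K x -> 0 <= f x) ->
  exists m : (size (cone_gens K)).-tuple bool,
    (K : set V) `&` [set x | f x = 0] = conic_hull (mask m (cone_gens K)).
Proof.
move=> f0; pose s := cone_gens K; rewrite cone_gensP -/s.
pose m := map (fun v => f v == 0) s.
have hm : size m == size s by rewrite size_map.
exists (Tuple hm) => /=; rewrite -filter_mask; apply/seteqP; split=> [x|].
  move=> [[c c0 ->] /=]; rewrite linear_sum /= => /eqP.
  have fs i : (i < size s)%N -> 0 <= f s`_i.
    move=> hi; apply: f0; rewrite cone_gensP; apply: conic_hull_gen.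
    exact: mem_nth.
  rewrite psumr_eq0 => [/allP h|i _]; last first.
    by rewrite linearZ mulr_ge0 ?fs.
  have [h0 hD hZ] := conic_hull_convex [seq v <- s | f v == 0].
  elim/big_ind: _ => // i _; have := h i (mem_index_enum i).
  rewrite linearZ /= mulf_eq0 => /orP[/eqP ->|fi]; first by rewrite scale0r.
  by apply: hZ => //; apply: conic_hull_gen; rewrite mem_filter fi mem_nth.
have [h0 hD hZ] := conic_hull_convex s.
apply: conic_hull_min => [|v]; last first.
  by rewrite mem_filter => /andP[/eqP fv vs]; split=> //; apply: conic_hull_gen.
split=> [|x y [hx fx] [hy fy]|a x a0 [hx fx]]; split=> /=.
- exact: h0.
- exact: linear0.
- exact: hD.
- by rewrite linearD /= [f x]fx [f y]fy addr0.
- exact: hZ.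
- by rewrite linearZ /= [f x]fx scaler0.
Qed.

Lemma finite_faces K : finite_set (faces K).
Proof.
pose g (m : (size (cone_gens K)).-tuple bool) : cone :=
  @Cone (conic_hull (mask m (cone_gens K))) (ex_intro _ _ erefl).
apply: (@sub_finite_set _ _ (g @` setT)); last exact: finite_image.
move=> F [f [/face_gens[m e] eF]]; exists m => //.
by apply: cone_inj; rewrite eF e.
Qed.

Definition valuation (A : zmodType) (f : cone -> A) :=
  forall K K' L, (L = (K : set V) `|` (K' : set V) :> set V) ->
    f L + f (cone_cap K K') = f K + f K'.

Definition cone_rel : set {freeg cone / int} :=
  [set r | exists K K' L, (L = (K : set V) `|` (K' : set V) :> set V) /\
     r = fgen L + fgen (cone_cap K K') - (fgen K + fgen K')].

Definition cone_group := presented cone_rel.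

HB.instance Definition _ := GRing.Zmodule.on cone_group.

Definition cone_class K : cone_group := pgen cone_rel K.

Lemma valuation_kills (A : zmodType) (f : cone -> A) :
  valuation f -> kills cone_rel f.
Proof.
move=> hf _ [K [K' [L [e ->]]]].
by rewrite raddfB /= !(raddfD (flift f)) /= !flift_gen (hf _ _ _ e) subrr.
Qed.

Definition induced (A : zmodType) (f : cone -> A) (hf : valuation f) :
  cone_group -> A := plift (valuation_kills hf).

HB.instance Definition _ (A : zmodType) (f : cone -> A) (hf : valuation f) :=
  GRing.Additive.on (induced hf).

Lemma induced_class (A : zmodType) (f : cone -> A) (hf : valuation f) K :
  induced hf (cone_class K) = f K.
Proof. exact: plift_gen. Qed.

Lemma cone_class_valuation : valuation cone_class.
Proof.
move=> K K' L e; apply/eqP; rewrite -subr_eq0 /cone_class /pgen.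
rewrite -!(raddfD (\pi_cone_group)) -raddfB.
by apply/eqP/pi_relator; exists K, K', L.
Qed.

(* faces K is finite by finite_faces, so this is a genuine finite sum. *)
Definition Delta K : tensor cone_group cone_group :=
  \sum_(F \in faces K)
    (cone_class F *t cone_class (cone_add (vs_cone (cone_span F)) K))
      *~ ((-1) ^+ cone_dim F).

Definition epsilon K : int :=
  if `[< is_subspace K >] then (-1) ^+ cone_dim K else 0.

End Cone.

(* Main.v *)
Require Import Defs.
From mathcomp Require Import all_boot all_order all_algebra.
From mathcomp Require Import boolp classical_sets reals.
From HB Require Import structures.
From mathcomp Require Import functions cardinality fsbigop.
From mathcomp Require Import lra.

Set Implicit Arguments.
Unset Strict Implicit.
Unset Printing Implicit Defensive.

Import Order.TTheory.
Import GRing.Theory.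
Import Num.Theory.
Local Open Scope ring_scope.
Local Open Scope classical_set_scope.

(** A function on cones is a valuation as soon as it is additive when a cone K is
    cut by a hyperplane f = 0 into K+ and K-, with K0 = K+ /\ K-.

    A face F of K is determined by any of its relative interior points p, and
    x lies in the tangent cone <F> + K iff x + t p lies in K for some t >= 0.
    Hence the faces of K+ are the F /\ K+ for the faces F of K with a relative
    interior point where f > 0, together with the faces of K0, which are the
    F /\ K0 for the F with a relative interior point where f = 0. Summing, the
    tangent cones at faces of K0 combine by additivity, and what remains is the
    additivity of [F] under the cut, with sign coming from
    dim (F /\ K0) = dim F - 1 when f changes sign on F.

    Coassociativity holds term by term: for a face G of K, the map
    F |-> <G> + F is a bijection from the faces of K containing G onto the
    faces of <G> + K, preserving linear spans. For the counit, the only face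
    that is a subspace is the lineality space of K, and <F> + K is a subspace
    only for F = K. *)

(** * Halfspace representations of polyhedral cones *)

Section HalfspaceRepresentation.
Variables (R : realType) (V : vectType R).
Implicit Types (K F : cone V) (f g h : 'Hom(V, R^o)).

(* Keeps values in R rather than in R^o, whose canonical structures block
   rewriting with the lemmas on ordered fields. *)
Definition ev f (x : V) : R := f x.

Lemma ev_is_scalar f : scalar (ev f).
Proof. by move=> a x y; rewrite /ev linearP. Qed.

HB.instance Definition _ f :=
  GRing.isLinear.Build R V R *%R (ev f) (ev_is_scalar f).

Lemma evD f x y : ev f (x + y) = ev f x + ev f y.
Proof. exact: linearD. Qed.

Lemma evB f x y : ev f (x - y) = ev f x - ev f y.
Proof. exact: linearB. Qed.

Lemma evN f x : ev f (- x) = - ev f x.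
Proof. exact: linearN. Qed.

Lemma ev0 f : ev f 0 = 0.
Proof. exact: linear0. Qed.

Lemma evZ f (a : R) x : ev f (a *: x) = a * ev f x.
Proof. exact: linearZ. Qed.

Lemma ev_opp f x : ev (- f) x = - ev f x.
Proof. by rewrite /ev opp_lfunE. Qed.

Lemma ev_comb (a b : R) g h x : ev (a *: g - b *: h) x = a * ev g x - b * ev h x.
Proof. by rewrite /ev add_lfunE opp_lfunE !scale_lfunE. Qed.

Lemma cone0 K : cone_set K 0.
Proof. by have [] := cone_convex K. Qed.

Lemma coneD K x y : cone_set K x -> cone_set K y -> cone_set K (x + y).
Proof. by have [_ h _] := cone_convex K; apply: h. Qed.

Lemma coneZ K (a : R) x : 0 <= a -> cone_set K x -> cone_set K (a *: x).
Proof. by have [_ _ h] := cone_convex K; apply: h. Qed.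

Lemma cone_eq K K' : (forall x, cone_set K x <-> cone_set K' x) -> K = K'.
Proof. by move=> e; apply: cone_inj; apply/seteqP; split=> x /e. Qed.

Lemma halfspace_coneP f : exists s, [set x | 0 <= ev f x] = conic_hull s.
Proof.
have [s es] := vs_coneP (fullv : {vspace V}).
have [s' es'] := conic_hull_halfspace (ev f) s.
exists s'; rewrite es' -es; apply/seteqP; split=> x /=; last by case.
by move=> ?; split=> //; exact: memvf.
Qed.

Definition halfspace f : cone V := Cone (halfspace_coneP f).

(* Fourier-Motzkin elimination of the parameter t. *)
Lemma eliminate_ray (s : seq 'Hom(V, R^o)) (v : V) :
  exists s' : seq 'Hom(V, R^o), forall x,
    (forall g, g \in s' -> 0 <= ev g x) <->
    (exists2 t : R, 0 <= t & forall g, g \in s -> 0 <= ev g (x - t *: v)).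
Proof.
pose sp := [seq g <- s | 0 <= ev g v]; pose sn := [seq g <- s | ev g v < 0].
exists (sp ++ [seq ev g v *: h - ev h v *: g | g <- sp, h <- sn]) => x.
have gE g (t : R) : ev g (x - t *: v) = ev g x - t * ev g v by rewrite evB evZ.
split=> [H|[t t0 H] g]; last first.
  rewrite mem_cat => /orP[|/allpairsP[[a b] /= [ha hb ->]]].
    rewrite mem_filter => /andP[gv gs]; have := H _ gs.
    by rewrite gE subr_ge0; apply: le_trans; apply: mulr_ge0.
  move: ha hb; rewrite !mem_filter => /andP[av /H ha] /andP[bv /H hb].
  rewrite ev_comb; move: ha hb av bv; rewrite !gE.
  move: (ev a v) (ev b v) (ev a x) (ev b x) => av bv ax bx; nra.
(* The least admissible parameter: the maximum of 0 and of the lower bounds imposed by forms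
   negative on [v]. It is attained, so each remaining condition reduces to one pairwise
   inequality. *)
have [t [t0 tn tE]] : exists t : R, [/\ 0 <= t,
    forall g, g \in sn -> ev g x / ev g v <= t &
    t = 0 \/ exists2 g, g \in sn & t = ev g x / ev g v].
  elim: (sn) => [|g l [t [t0 tl tE]]].
    by exists 0; split=> //; left.
  have [gt|tg] := lerP (ev g x / ev g v) t.
    exists t; split=> //.
      by move=> h; rewrite inE => /predU1P[->|/tl].
    by case: tE => [->|[h hl ->]]; [left|right; exists h => //; rewrite inE hl orbT].
  exists (ev g x / ev g v); split=> //.
  - exact: le_trans t0 (ltW tg).
  - by move=> h; rewrite inE => /predU1P[->//|/tl ht]; apply: le_trans ht (ltW tg).
  - by right; exists g => //; rewrite mem_head.
exists t => // g gs; rewrite gE.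
have [gv|gv] := ltP (ev g v) 0.
  have := tn g; rewrite mem_filter gv gs => /(_ isT).
  by rewrite ler_ndivrMr // subr_ge0.
have gsp : g \in sp by rewrite mem_filter gv.
have gx : 0 <= ev g x by apply: H; rewrite mem_cat gsp.
case: tE => [->|[h hs ->]]; first by rewrite mul0r subr0.
have : 0 <= ev (ev g v *: h - ev h v *: g) x.
  apply: H; rewrite mem_cat; apply/orP; right.
  by apply/allpairsP; exists (g, h).
move: hs; rewrite ev_comb mem_filter => /andP[hv _].
by rewrite mulrAC !subr_ge0 ler_ndivrMr // mulrC [ev g v * _]mulrC.
Qed.

(** Minkowski-Weyl, by induction on the generators: the zero cone is cut out by the coordinate forms
    and their opposites, and a new generator [v] amounts to eliminating the parameter of its ray. *)
Lemma conic_hull_hrep (l : seq V) : exists s : seq 'Hom(V, R^o), forall x,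
  conic_hull l x <-> (forall g, g \in s -> 0 <= ev g x).
Proof.
elim: l => [|v l [s es]].
  pose c i : 'Hom(V, R^o) := 
    linfun (coord (vbasis (fullv : {vspace V})) i : V -> R^o).
  exists (map c (enum 'I_(\dim {:V})) ++
          map (fun i => - c i) (enum 'I_(\dim {:V}))).
  move=> x; split=> [[d _ ->] g _|H]; first by rewrite big_ord0 ev0.
  exists (fun=> 0) => //; rewrite big_ord0 (coord_vbasis (memvf x)) big1 // => i _.
  suff -> : coord (vbasis fullv) i x = 0 by rewrite scale0r.
  have e : ev (c i) x = coord (vbasis fullv) i x by rewrite /ev lfunE.
  apply/eqP; rewrite eq_le -{1}oppr_ge0 -e -ev_opp.
  rewrite !H // mem_cat; first by rewrite map_f ?mem_enum.
  by rewrite (map_f (fun i => - c i)) ?mem_enum ?orbT.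
have [s' es'] := eliminate_ray s v; exists s' => x; rewrite es'.
rewrite -[v :: l]/([:: v] ++ l) conic_hull_cat; split=> [[y [z [hy hz ->]]]|].
  case: hy => c c0 ->; exists (c 0) => // g gs.
  by rewrite big_ord1 addrC addKr; apply es.
move=> [t t0 H]; exists (t *: v), (x - t *: v); split.
- by exists (fun=> t) => //; rewrite big_ord1.
- exact/es.
- by rewrite addrC subrK.
Qed.

Lemma cone_hrep K : exists s : seq 'Hom(V, R^o), forall x,
  cone_set K x <-> (forall g, g \in s -> 0 <= ev g x).
Proof. by rewrite cone_gensP; apply: conic_hull_hrep. Qed.

End HalfspaceRepresentation.

(** * Reduction of the valuation property to hyperplane cuts *)

Section Cuts.
Variables (R : realType) (V : vectType R).
Implicit Types (K F : cone V) (f g h : 'Hom(V, R^o)).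

Lemma halfspaceN f x : cone_set (halfspace (- f)) x = (ev f x <= 0) :> Prop.
Proof. by rewrite -oppr_ge0 -ev_opp. Qed.

Lemma cone_closed K x y :
  (forall e : R, 0 < e -> cone_set K (x + e *: y)) -> cone_set K x.
Proof.
have [s es] := cone_hrep K => H; apply/es => g gs.
have gE (e : R) : 0 < e -> 0 <= ev g x + e * ev g y.
  by move=> /H/es/(_ g gs); rewrite evD evZ.
rewrite leNgt; apply/negP => gx.
have [gy|gy] := lerP (ev g y) 0; first by have := gE 1 ltr01; lra.
(* For this [e] the form takes the value [ev g x / 2], which is still negative. *)
have := gE (- ev g x / (2 * ev g y)); rewrite divr_gt0 ?oppr_gt0 ?mulr_gt0 //.
move=> /(_ isT); suff -> : - ev g x / (2 * ev g y) * ev g y = - ev g x / 2 by lra.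
by rewrite invfM mulrA divfK // gt_eqF.
Qed.

Lemma cone_cap_id K K' :
  (forall x, cone_set K' x -> cone_set K x) -> cone_cap K K' = K'.
Proof. by move=> s; apply: cone_eq => x; split=> [[]//|Kx]; split=> //; apply: s. Qed.

Definition cut_valuation (A : zmodType) (phi : cone V -> A) := forall K f,
  phi K + phi (cone_cap (cone_cap K (halfspace f)) (cone_cap K (halfspace (- f)))) =
  phi (cone_cap K (halfspace f)) + phi (cone_cap K (halfspace (- f))).

(* Induction on the number of halfspaces cutting out K in L: if the first one,
   g >= 0, is not redundant, the part of L where g <= 0 lies in K'. *)
Lemma cut_valuation_valuation (A : zmodType) (phi : cone V -> A) :
  cut_valuation phi -> valuation phi.
Proof.
move=> cut K K' L eL; have [s es] := cone_hrep K.
(* The forms are taken relative to [L], so that the induction may replace [L] by its part in a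
   halfspace. *)
have {es}: forall x, cone_set K x <->
    cone_set L x /\ forall g, g \in s -> 0 <= ev g x.
  by move=> x; rewrite es eL; split=> [h|[]//]; split=> //; left; apply/es.
have {eL}: forall x, cone_set L x <-> cone_set K x \/ cone_set K' x by rewrite eL.
elim: s K' L => [|g s IH] K' L eL eK.
  have -> : L = K by apply: cone_eq => x; rewrite eK; split=> [?|[]//]; split.
  by rewrite cone_cap_id // => x K'x; apply/eK; split=> //; apply/eL; right.
have [[y [Ly gy]]|noy] := pselect (exists y, cone_set L y /\ ev g y < 0); last first.
  apply: (IH) => // x; rewrite eK; split=> -[Lx h]; split=> // g'.
    by move=> g's; apply: h; rewrite inE g's orbT.
  rewrite inE => /predU1P[->|/h//]; rewrite leNgt; apply/negP => gx.
  by apply: noy; exists x.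
have Kg x : cone_set K x -> 0 <= ev g x.
  by move=> /eK[_]; apply; rewrite mem_head.
have LK' x : cone_set L x -> ev g x < 0 -> cone_set K' x.
  by move=> /eL[/Kg|//]; rewrite leNgt => /negP.
(* Points with [ev g x = 0] are limits of the points [x + e *: y], where [g] is negative. *)
have LK'0 x : cone_set L x -> ev g x <= 0 -> cone_set K' x.
  move=> Lx gx; apply: (@cone_closed _ _ y) => e e0; apply: LK'.
    by apply: coneD => //; apply: coneZ => //; apply: ltW.
  by rewrite evD evZ; nra.
have K'L x : cone_set K' x -> cone_set L x by move=> ?; apply/eL; right.
have := IH (cone_cap K' (halfspace g)) (cone_cap L (halfspace g)).
have -> : cone_cap K (cone_cap K' (halfspace g)) = cone_cap K K'.
  apply: cone_eq => x; split=> [[Kx [K'x _]]|[Kx K'x]]; split=> //; split=> //.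
  exact: Kg.
move=> {}IH; have {}IH : phi (cone_cap L (halfspace g)) + phi (cone_cap K K') =
    phi K + phi (cone_cap K' (halfspace g)).
  apply: IH => x; split.
  - by move=> [/eL[Kx|K'x] gx]; [left|right].
  - case=> [Kx|[K'x gx]]; split=> //; [|exact: Kg|exact: K'L].
    by apply/eL; left.
  - move=> Kx; split; first by split; [apply/eL; left|apply: Kg].
    by move=> g' g's; have [_] := (eK x).1 Kx; apply; rewrite inE g's orbT.
  - move=> [[Lx gx] h]; apply/eK; split=> // g'.
    by rewrite inE => /predU1P[->|/h].
have cutL := cut L g; have cutK' := cut K' g.
have eN : cone_cap L (halfspace (- g)) = cone_cap K' (halfspace (- g)).
  apply: cone_eq => x; split=> -[Lx gx]; split=> //; last exact: K'L.
  by move: gx; rewrite halfspaceN; apply: LK'0.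
have e0 : cone_cap (cone_cap L (halfspace g)) (cone_cap L (halfspace (- g))) =
          cone_cap (cone_cap K' (halfspace g)) (cone_cap K' (halfspace (- g))).
  rewrite eN; apply: cone_eq => x; split=> -[[Lx gx] [K'x ngx]]; do 2 split=> //.
  exact: K'L.
(* [L] and [K'] have the same part in [g <= 0] and the same slice on [g = 0], so the difference of
   their cut relations combines with [IH]. *)
move: cutL cutK'; rewrite e0 eN.
set a := phi (cone_cap (cone_cap K' _) _) => cutL cutK'.
apply: (addIr a); rewrite addrAC cutL -[RHS]addrA cutK' addrA -IH.
by rewrite [RHS]addrAC.
Qed.

End Cuts.

(** * Relative interiors, faces and tangent cones *)

Section RelativeInterior.
Variables (R : realType) (V : vectType R).
Implicit Types (K F G : cone V) (f g h : 'Hom(V, R^o)) (x y p : V).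

(** For [x] and [y] in [K], this says that [y] lies in the smallest face of [K] containing [x]. *)
Definition below K x y := exists2 e : R, 0 < e & cone_set K (x - e *: y).

(** The relative interior in algebraic form, without topology. *)
Definition relint K p := cone_set K p /\ forall y, cone_set K y -> below K p y.

(** The intrinsic notion of a face, with no supporting form; [facesP] shows that it agrees with
    [faces]. *)
Definition extreme K F := (forall x, cone_set F x -> cone_set K x) /\
  forall x y, cone_set K x -> cone_set K y -> cone_set F (x + y) -> cone_set F x.

Lemma below_convex K x : cone_set K x -> convex_cone (below K x).
Proof.
move=> Kx; split.
- by exists 1; rewrite ?scaler0 ?subr0.
- move=> y z [d d0 Kd] [e e0 Ke].
  have de0 : 0 < d + e by exact: addr_gt0.
  (* This step makes the point a convex combination of [x - d *: y] and [x - e *: z], with weights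
     [e / (d + e)] and [d / (d + e)]. *)
  exists ((d + e)^-1 * (d * e)); first by rewrite !mulr_gt0 ?invr_gt0.
  have -> : x - ((d + e)^-1 * (d * e)) *: (y + z) =
      (d + e)^-1 *: (e *: (x - d *: y) + d *: (x - e *: z)).
    rewrite !scalerBr addrACA -scalerDl [e + d]addrC -opprD !scalerA [e * d]mulrC.
    by rewrite -scalerDr scalerBr !scalerA mulVf ?scale1r // gt_eqF.
  by apply: coneZ; [rewrite invr_ge0 ltW|apply: coneD; apply: coneZ => //; apply: ltW].
- move=> a y; rewrite le_eqVlt => /predU1P[<- _|a0 [e e0 Ke]].
    by exists 1; rewrite ?scale0r ?scaler0 ?subr0.
  by exists (e / a); rewrite ?divr_gt0 // scalerA divfK // gt_eqF.
Qed.

(** The sum of the generators works: removing one of them leaves a point of the cone, and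
    [below_convex] passes from generators to all vectors. *)
Lemma relint_exists K : exists p, relint K p.
Proof.
pose s := cone_gens K; pose p := \sum_(v <- s) v.
have Ks v : v \in s -> cone_set K v by rewrite cone_gensP; apply: conic_hull_gen.
have Ksum (t : seq V) : {subset t <= s} -> cone_set K (\sum_(v <- t) v).
  move=> ts; rewrite big_seq; elim/big_ind: _ => [|x y|v /ts].
  - exact: cone0.
  - exact: coneD.
  - exact: Ks.
exists p; split=> [|y]; first exact: Ksum.
rewrite [X in X y -> _]cone_gensP; apply: conic_hull_min.
  by apply: below_convex; apply: Ksum.
move=> v vs; exists 1 => //; rewrite scale1r /p (big_rem v) //= addrC addrK.
by apply: Ksum => w /mem_rem.
Qed.

(** A form positive at [p] survives a small step, and a form vanishing at [p] is not positive at
    [x]; finitely many forms leave a common step. *)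
Lemma small_step (s : seq 'Hom(V, R^o)) p x :
  (forall g, g \in s -> 0 <= ev g p /\ (ev g p = 0 -> ev g x <= 0)) ->
  exists2 e : R, 0 < e & forall g, g \in s -> 0 <= ev g (p - e *: x).
Proof.
elim: s => [|g s IH] H; first by exists 1.
have [|e e0 He] := IH; first by move=> h hs; apply: H; rewrite inE hs orbT.
have [g0 gx] := H g (mem_head _ _).
(* A form nonnegative at both ends of the segment from [p] to [p - d *: x] is nonnegative in
   between. *)
have shrink (d d' : R) h : 0 <= d' <= d -> 0 <= ev h p ->
    0 <= ev h (p - d *: x) -> 0 <= ev h (p - d' *: x).
  rewrite !evB !evZ; move: (ev h p) (ev h x) => a b /andP[d'0 d'd] a0 ab.
  by have [b0|b0] := lerP 0 b; nra.
have [d d0 Hd] : exists2 d : R, 0 < d & 0 <= ev g (p - d *: x).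
  have [gx0|gx0] := lerP (ev g x) 0.
    by exists 1 => //; rewrite evB evZ; lra.
  have gp : 0 < ev g p.
    by rewrite lt_neqAle g0 andbT; apply/eqP => e1; move: gx0; rewrite ltNge gx.
  by exists (ev g p / ev g x); rewrite ?divr_gt0 // evB evZ divfK ?subrr // gt_eqF.
exists (Num.min d e); first by rewrite lt_min d0.
have m0 : 0 <= Num.min d e by rewrite le_min !ltW.
move=> h; rewrite inE => /predU1P[->|hs].
  by apply: shrink Hd; rewrite // m0 ge_min lexx.
apply: shrink (He _ hs); first by rewrite m0 ge_min lexx orbT.
by have [] := H h; rewrite // inE hs orbT.
Qed.

(* The form is the sum of the forms of an H-representation vanishing at p. *)
Lemma exposing_form K p : cone_set K p -> exists f,
  (forall x, cone_set K x -> 0 <= ev f x) /\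
  (forall x, cone_set K x -> ev f x = 0 <-> below K p x).
Proof.
have [s es] := cone_hrep K => Kp.
pose f : 'Hom(V, R^o) := \sum_(g <- s | ev g p == 0) g.
have fE x : ev f x = \sum_(g <- s | ev g p == 0) ev g x.
  by rewrite /ev /f sum_lfunE.
have Kg x g : cone_set K x -> g \in s -> 0 <= ev g x by move=> /es; apply.
have f0 x : cone_set K x -> 0 <= ev f x.
  by move=> Kx; rewrite fE big_seq_cond sumr_ge0 // => g /andP[gs _]; apply: Kg.
exists f; split=> // x Kx; split=> [/eqP|[e e0 Ke]]; last first.
  apply/eqP; rewrite eq_le f0 // andbT.
  have := f0 _ Ke; rewrite evB evZ.
  have -> : ev f p = 0 by rewrite fE big1 // => g /eqP.
  by rewrite sub0r oppr_ge0 pmulr_rle0.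
rewrite fE big_seq_cond psumr_eq0 => [/allP h|g /andP[gs _]]; last exact: Kg.
have [|e e0 He] := @small_step s p x; last by exists e => //; apply/es.
move=> g gs; split=> [|/eqP gp]; first exact: Kg.
by have := h g gs; rewrite gs gp /= => /eqP ->.
Qed.

Lemma cone_unscale K (a : R) x : 0 < a -> cone_set K (a *: x) -> cone_set K x.
Proof.
move=> a0 /(coneZ (_ : 0 <= a^-1)); rewrite scalerA mulVf ?scale1r ?gt_eqF //.
by apply; rewrite invr_ge0 ltW.
Qed.

(** [p] is the sum of [e *: x] and [p - e *: x], both in [K], so the face property applies. *)
Lemma extreme_below K F p x : extreme K F -> cone_set F p -> cone_set K x ->
  below K p x -> cone_set F x.
Proof.
move=> [_ h] Fp Kx [e e0 Ke]; apply: (cone_unscale e0).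
apply: (h _ (p - e *: x)) => //.
  by apply: coneZ => //; apply: ltW.
by rewrite addrC subrK.
Qed.

(** For an intrinsic face, take a form exposing a relative interior point [p] of [F]: on [K] it
    vanishes exactly at the points below [p], and these form [F]. *)
Lemma facesP K F : faces K F <-> extreme K F.
Proof.
split=> [[f [f0 eF]]|eF].
  rewrite /extreme eF; split=> [x []//|x y Kx Ky [_ fxy]]; split=> //.
  have := f0 _ Kx; have := f0 _ Ky; rewrite -![f _]/(ev f _) => fy fx.
  have {fxy} : ev f (x + y) = 0 by [].
  by rewrite evD => fxy; rewrite /= -[f x]/(ev f x); lra.
have [p [Fp Rp]] := relint_exists F.
have [f [f0 fE]] := exposing_form (eF.1 _ Fp).
exists f; split=> //; apply/seteqP; split=> x.
  move=> Fx; split; first exact: eF.1.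
  by apply/fE; [exact: eF.1|have [e e0 /eF.1] := Rp _ Fx; exists e].
by move=> [Kx /fE]; move/(_ Kx); apply: extreme_below.
Qed.

(** The face is the zero set on [K] of a form exposing [p], written with [- f >= 0] because [f] is
    nonnegative on [K]. *)
Lemma face_at K p : cone_set K p -> exists2 F, extreme K F & relint F p.
Proof.
move=> Kp; have [f [f0 fE]] := exposing_form Kp.
exists (cone_cap K (halfspace (- f))).
  split=> [x []//|x y Kx Ky [_]]; rewrite halfspaceN evD => fxy; split=> //.
  by rewrite halfspaceN; have := f0 _ Kx; have := f0 _ Ky; lra.
have fp : ev f p = 0.
  by apply/(fE _ Kp); exists 1; rewrite // scale1r subrr; apply: cone0.
split=> [|x [Kx]]; first by split=> //; rewrite halfspaceN fp.
rewrite halfspaceN => fx.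
have {}fx : ev f x = 0 by apply/eqP; rewrite eq_le fx f0.
have [e e0 Ke] := (fE _ Kx).1 fx; exists e => //; split=> //.
by rewrite halfspaceN evB evZ fp fx mulr0 subr0.
Qed.

(** Every point of [F] is below [p] in [K], hence absorbed by any face through [p]. *)
Lemma extreme_relint_sub K F F' p : (forall x, cone_set F x -> cone_set K x) ->
  extreme K F' -> relint F p -> cone_set F' p ->
  forall x, cone_set F x -> cone_set F' x.
Proof.
move=> FK eF' [Fp Rp] F'p x Fx; apply: extreme_below eF' F'p (FK _ Fx) _.
by have [e e0 /FK] := Rp _ Fx; exists e.
Qed.

Lemma extreme_relint_inj K F F' p : extreme K F -> extreme K F' ->
  relint F p -> relint F' p -> F = F'.
Proof.
move=> eF eF' Rp Rp'; apply: cone_eq => x; split.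
  exact: extreme_relint_sub eF.1 eF' Rp Rp'.1 x.
exact: extreme_relint_sub eF'.1 eF Rp' Rp.1 x.
Qed.

(** A large multiple of [p] makes up for the negative coefficients in a combination of
    generators. *)
Lemma mem_cone_span F p u : relint F p ->
  u \in cone_span F <-> exists2 t : R, 0 <= t & cone_set F (u + t *: p).
Proof.
move=> [Fp Rp].
have Fspan x : cone_set F x -> x \in cone_span F.
  by move=> Fx; apply: (cone_spanP F (cone_span F)).1 => //; apply: subvv.
split=> [uF|[t t0 /Fspan]]; last first.
  by move=> h; rewrite -(addrK (t *: p) u); apply: memvB => //; apply/memvZ/Fspan.
have := @coord_span _ _ _ (in_tuple (cone_gens F)) u uF => ->.
elim/big_ind: _ => [|x y [a a0 Fa] [b b0 Fb]|i _].
- by exists 0; rewrite // scale0r addr0; apply: cone0.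
- by exists (a + b); rewrite ?addr_ge0 // scalerDl addrACA; apply: coneD.
have Fv : cone_set F (cone_gens F)`_i.
  by rewrite [X in X _]cone_gensP; apply: conic_hull_gen; apply: mem_nth.
set c := coord _ _ _; set v := _`_i.
have [c0|c0] := lerP 0 c.
  by exists 0; rewrite // scale0r addr0; apply: coneZ.
have [e e0 Fe] := Rp _ Fv.
have h : 0 <= - c / e by rewrite divr_ge0 ?oppr_ge0 // ltW.
(* [c *: v + (- c / e) *: p] equals [(- c / e) *: (p - e *: v)]. *)
exists (- c / e) => //; have := coneZ h Fe.
by rewrite scalerBr scalerA divfK ?gt_eqF // scaleNr opprK addrC.
Qed.

Definition tangent K F := cone_add (vs_cone (cone_span F)) K.

(** A vector of the span of [F] enters [F] once a multiple of [p] is added, so the subspace summand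
    reduces to multiples of [p]. *)
Lemma tangentP K F p x : (forall y, cone_set F y -> cone_set K y) -> relint F p ->
  cone_set (tangent K F) x <-> exists2 t : R, 0 <= t & cone_set K (x + t *: p).
Proof.
move=> FK Rp; split=> [[u [k [/= uF Kk ->]]]|[t t0 Kt]].
  have [t t0 Ft] := (mem_cone_span u Rp).1 uF.
  by exists t => //; rewrite addrAC; apply: coneD => //; apply: FK.
exists (- t *: p), (x + t *: p); split=> //=; last by rewrite addrCA scaleNr addNr addr0.
rewrite memvZ //; apply: (mem_cone_span p Rp).2; exists 0 => //.
by rewrite scale0r addr0; exact: Rp.1.
Qed.

End RelativeInterior.

(** * Faces under a hyperplane cut, and the valuation property of [Delta] *)

Section HyperplaneCut.
Variables (R : realType) (V : vectType R).
Implicit Types (K F G T : cone V) (f : 'Hom(V, R^o)) (x y p q : V).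

Lemma relintD F p y : relint F p -> cone_set F y -> relint F (p + y).
Proof.
move=> [Fp Rp] Fy; split=> [|x /Rp[e e0 Fe]]; first exact: coneD.
by exists e => //; rewrite addrAC; apply: coneD.
Qed.

Lemma relintZ F (a : R) p : 0 < a -> relint F p -> relint F (a *: p).
Proof.
move=> a0 [Fp Rp]; split=> [|x /Rp[e e0 Fe]]; first exact: coneZ (ltW a0) Fp.
exists (a * e); first exact: mulr_gt0.
by rewrite -scalerA -scalerBr; apply: coneZ => //; apply: ltW.
Qed.

Lemma relint_pos F f y : cone_set F y -> 0 < ev f y ->
  exists2 p, relint F p & 0 < ev f p.
Proof.
move=> Fy fy; have [p Rp] := relint_exists F.
(* The added term contributes one more than the absolute value of [ev f p]. *)
exists (p + ((`|ev f p| + 1) / ev f y) *: y).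
  by apply: relintD => //; apply: coneZ Fy; rewrite divr_ge0 ?addr_ge0 // ltW.
rewrite evD evZ divfK ?gt_eqF //.
by have := ler_norm (- ev f p); rewrite normrN; lra.
Qed.

Lemma eq_span F F' p : relint F p -> relint F' p ->
  (forall x, (exists2 t : R, 0 <= t & cone_set F (x + t *: p)) <->
             (exists2 t : R, 0 <= t & cone_set F' (x + t *: p))) ->
  cone_span F = cone_span F'.
Proof.
move=> Rp Rp' e; apply/vspaceP => x; apply/idP/idP => /(mem_cone_span _ _).1 h;
  apply/mem_cone_span; [exact: Rp'|apply/e; exact: h|exact: Rp|apply/e; exact: h].
Qed.

(* Adding a large multiple of p moves any point into the halfspace f >= 0. *)
Lemma cut_ray K K' f p x : (forall y, cone_set K' y <-> cone_set K y /\ 0 <= ev f y) ->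
  cone_set K p -> 0 < ev f p ->
  (exists2 t : R, 0 <= t & cone_set K (x + t *: p)) <->
  (exists2 t : R, 0 <= t & cone_set K' (x + t *: p)).
Proof.
move=> eK' Kp fp; split=> -[t t0]; last by move=> /eK'[Kt _]; exists t.
move=> Kt; pose s := `|ev f (x + t *: p)| / ev f p.
have s0 : 0 <= s by rewrite divr_ge0 // ltW.
exists (t + s); first exact: addr_ge0.
rewrite scalerDl addrA; apply/eK'; split; first by apply: coneD => //; apply: coneZ.
rewrite evD [ev f (s *: p)]evZ /s divfK ?gt_eqF //.
by have := ler_norm (- ev f (x + t *: p)); rewrite normrN; lra.
Qed.

Lemma relint_cut F F' f p : (forall y, cone_set F' y <-> cone_set F y /\ 0 <= ev f y) ->
  relint F p -> 0 < ev f p -> relint F' p.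
Proof.
move=> eF' [Fp Rp] fp; split=> [|x /eF'[Fx fx]]; first by apply/eF'; rewrite ltW.
have [e e0 Fe] := Rp _ Fx.
have c0 : 0 < ev f p + e * ev f x by rewrite ltr_wpDr // mulr_ge0 // ltW.
(* After scaling by the denominator the point is [ev f p *: (p - e *: x) + (e * ev f x) *: p], where
   [f] equals the square of [ev f p]. *)
exists ((ev f p + e * ev f x)^-1 * (e * ev f p)).
  by rewrite !mulr_gt0 // invr_gt0.
apply: (cone_unscale c0); rewrite scalerBr scalerA mulVKf ?gt_eqF //.
rewrite scalerDl addrAC [e * ev f p]mulrC -scalerA -scalerBr addrC; apply/eF'.
have fx0 : 0 <= e * ev f x by rewrite mulr_ge0 // ltW.
split; first by apply: coneD; apply: coneZ => //; apply: ltW.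
by rewrite evD !evZ evB evZ; nra.
Qed.

Lemma relint_cut0 F F' f p : (forall y, cone_set F' y <-> cone_set F y /\ ev f y = 0) ->
  relint F p -> ev f p = 0 -> relint F' p.
Proof.
move=> eF' [Fp Rp] fp; split=> [|x /eF'[Fx fx]]; first by apply/eF'.
have [e e0 Fe] := Rp _ Fx; exists e => //; apply/eF'; split=> //.
by rewrite evB evZ fp fx mulr0 subr0.
Qed.

Definition meets_relint (B : set V) : set (cone V) :=
  [set F | exists2 p, relint F p & B p].

Lemma extreme_cap K K' F : (forall x, cone_set K' x -> cone_set K x) ->
  extreme K F -> extreme K' (cone_cap F K').
Proof.
move=> sK [FK eF]; split=> [x []//|x y K'x K'y [Fxy _]].
by split=> //; apply: eF Fxy; apply: sK.
Qed.

(** Intersecting with [K'] is a bijection on these faces: a relative interior point in [B] recovers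
    [F] from its slice, and the face of [K] around such a point of [G] slices back to [G]. *)
Lemma slice_sum (A : zmodType) K K' (B : set V) (phi : cone V -> A) :
  (forall x, cone_set K' x -> cone_set K x) ->
  (forall F p, extreme K F -> relint F p -> B p -> relint (cone_cap F K') p) ->
  \sum_(G \in faces K' `&` meets_relint B) phi G =
  \sum_(F \in faces K `&` meets_relint B) phi (cone_cap F K').
Proof.
move=> sK Brel; apply: reindex_fsbig; split.
- move=> F [/facesP eF [p Rp Bp]]; split; last by exists p => //; apply: Brel.
  by apply/facesP; apply: extreme_cap eF.
- move=> F F' /set_mem[/facesP eF [p Rp Bp]] /set_mem[/facesP eF' [p' Rp' Bp']] e.
  have [Fp' _] := Brel _ _ eF Rp Bp; have [Fp _] := Brel _ _ eF' Rp' Bp'.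
  rewrite e in Fp'; rewrite -e in Fp.
  apply: cone_eq => x; split.
    exact: extreme_relint_sub eF.1 eF' Rp Fp'.1 x.
  exact: extreme_relint_sub eF'.1 eF Rp' Fp.1 x.
- move=> G [/facesP eG [q Rq Bq]].
  have [F eF RFq] := face_at (sK _ (eG.1 _ Rq.1)).
  exists F; first by split; [apply/facesP|exists q].
  exact: extreme_relint_inj (extreme_cap sK eF) eG (Brel _ _ eF RFq Bq) Rq.
Qed.

Lemma tangent_eq K F K' F' p q : (forall y, cone_set F y -> cone_set K y) ->
  relint F p -> (forall y, cone_set F' y -> cone_set K' y) -> relint F' q ->
  (forall x, (exists2 t : R, 0 <= t & cone_set K (x + t *: p)) <->
             (exists2 t : R, 0 <= t & cone_set K' (x + t *: q))) ->
  tangent K F = tangent K' F'.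
Proof.
move=> FK Rp FK' Rp' e; apply: cone_eq => x.
by rewrite (tangentP x FK Rp) (tangentP x FK' Rp') e.
Qed.

(** Faces of [Kp] with a relative interior point in [f > 0] come from faces of [K] and keep their
    tangent cones by [cut_ray]; the other faces of [Kp] are exactly those of [K0]. *)
Lemma sum_halfspace (A : zmodType) (phi : cone V -> cone V -> A) K f Kp K0 :
  (forall x, cone_set Kp x <-> cone_set K x /\ 0 <= ev f x) ->
  (forall x, cone_set K0 x <-> cone_set K x /\ ev f x = 0) ->
  \sum_(F \in faces Kp) phi F (tangent Kp F) =
    \sum_(F \in faces K `&` meets_relint [set p | 0 < ev f p])
      phi (cone_cap F Kp) (tangent K F) +
    \sum_(G \in faces K0) phi G (tangent Kp G).
Proof.
move=> eKp eK0.
rewrite (fsbigID (meets_relint [set p | 0 < ev f p])); last exact: finite_faces.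
have capE F : extreme K F ->
    forall y, cone_set (cone_cap F Kp) y <-> cone_set F y /\ 0 <= ev f y.
  move=> [FK _] y; split=> [[Fy /eKp[]]//|[Fy fy]]; split=> //.
  by apply/eKp; split=> //; apply: FK.
congr (_ + _).
  have KpK x : cone_set Kp x -> cone_set K x by move=> /eKp[].
  have Brel F p : extreme K F -> relint F p -> [set p | 0 < ev f p] p ->
      relint (cone_cap F Kp) p.
    by move=> eF Rp fp; apply: relint_cut (capE _ eF) Rp fp.
  rewrite (slice_sum (fun G => phi G (tangent Kp G)) KpK Brel).
  apply: eq_fsbigr => F /set_mem[/facesP eF [p Rp fp]]; congr (phi _ _).
  have Rp' := relint_cut (capE _ eF) Rp fp.
  apply: (tangent_eq _ Rp' eF.1 Rp) => [y []//|x].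
  by rewrite (cut_ray x eKp (eF.1 _ Rp.1) fp).
apply: eq_fsbigl; apply/seteqP; split=> G.
  move=> [/facesP eG nB]; apply/facesP.
  have [q [Gq Rq]] := relint_exists G.
  have fq : ev f q = 0.
    have /eKp[_] := eG.1 _ Gq; rewrite le_eqVlt => /predU1P[//|fq].
    by case: nB; exists q.
  (* [f] is nonnegative on [G] and vanishes at the relative interior point [q], hence vanishes on
     [G]. *)
  split=> [x Gx|x y /eK0[Kx fx] /eK0[Ky fy]].
    have [Kx fx] := (eKp _).1 (eG.1 _ Gx); apply/eK0; split=> //.
    have [e e0 /eG.1/eKp[_]] := Rq _ Gx.
    rewrite evB evZ fq sub0r oppr_ge0 pmulr_rle0 // => fx'.
    by apply/eqP; rewrite eq_le fx'.
  by apply: eG.2; apply/eKp; rewrite ?fx ?fy.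
move=> /facesP[GK eG].
have sK x : cone_set G x -> cone_set K x /\ ev f x = 0 by move=> /GK/eK0.
split; last by move=> [p [/sK[_ fp] _]] /=; rewrite fp ltxx.
apply/facesP; split=> [x /sK[Kx fx]|x y /eKp[Kx fx] /eKp[Ky fy] Gxy].
  by apply/eKp; rewrite fx.
have [_] := sK _ Gxy; rewrite evD => fxy.
by apply: eG Gxy; apply/eK0; split=> //; lra.
Qed.

(** Rank-nullity for [f] on the span of [F]: the image is a line, and the kernel is the span of [F0]
    because both cones have [p] in their relative interiors. *)
Lemma dim_cut0 F F0 f : (forall x, cone_set F0 x <-> cone_set F x /\ ev f x = 0) ->
  (exists2 p, relint F p & ev f p = 0) -> (exists2 y, cone_set F y & ev f y != 0) ->
  cone_dim F = (cone_dim F0).+1.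
Proof.
move=> eF0 [p Rp fp] [y Fy fy].
have Rp0 := relint_cut0 eF0 Rp fp.
have -> : cone_dim F0 = \dim (cone_span F :&: lker f).
  rewrite /cone_dim; congr (\dim _); apply/vspaceP => x; rewrite memv_cap memv_ker.
  have fE t : ev f (x + t *: p) = ev f x by rewrite evD evZ fp mulr0 addr0.
  apply/idP/andP => [/(mem_cone_span _ Rp0).1[t t0 /eF0[Ft]]|[h /eqP fx]].
    by rewrite fE => /eqP fx; split=> //; apply/(mem_cone_span _ Rp); exists t.
  apply/(mem_cone_span _ Rp0); have [t t0 Ft] := (mem_cone_span _ Rp).1 h.
  by exists t => //; apply/eF0; rewrite fE.
rewrite /cone_dim -(limg_ker_dim f (cone_span F)) -addn1; congr (_ + _)%N.
apply/eqP; rewrite eqn_leq; apply/andP; split.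
  by apply: leq_trans (dimvS (subvf _)) _; rewrite dimvf.
rewrite lt0n dimv_eq0; apply/eqP => e.
have : f y \in (f @: cone_span F)%VS.
  by apply: memv_img; apply: (cone_spanP F (cone_span F)).1 => //; apply: subvv.
by rewrite e memv0; apply/negP.
Qed.

(** [T] is independent of [F] because [face_cut] cuts [F] while holding [T] fixed. *)
Definition face_term F T : tensor (cone_group V) (cone_group V) :=
  (cone_class F *t cone_class T) *~ ((-1) ^+ cone_dim F).

Lemma DeltaE K : Delta K = \sum_(F \in faces K) face_term F (tangent K F).
Proof. by []. Qed.

(** If [f] takes both signs on [F], all three terms occur and the identity is the cut relation
    between the four classes. Otherwise exactly one term occurs, and its cone is [F] itself. *)
Lemma face_cut K f Kp Km K0 F T :
  (forall x, cone_set Kp x <-> cone_set K x /\ 0 <= ev f x) ->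
  (forall x, cone_set Km x <-> cone_set K x /\ ev f x <= 0) ->
  (forall x, cone_set K0 x <-> cone_set K x /\ ev f x = 0) ->
  extreme K F ->
  face_term F T =
    (if F \in meets_relint [set p | 0 < ev f p] then face_term (cone_cap F Kp) T else 0) +
    (if F \in meets_relint [set p | ev f p < 0] then face_term (cone_cap F Km) T else 0) +
    (if F \in meets_relint [set p | ev f p = 0] then face_term (cone_cap F K0) T else 0).
Proof.
move=> eKp eKm eK0 [FK _].
have capE (K' : cone V) (P : V -> Prop) :
    (forall x, cone_set K' x <-> cone_set K x /\ P x) ->
    forall x, cone_set (cone_cap F K') x <-> cone_set F x /\ P x.
  move=> eK' x; split=> [[Fx /eK'[]]//|[Fx Px]]; split=> //.
  by apply/eK'; split=> //; apply: FK.
have {eKp} eKp := capE _ _ eKp; have {eKm} eKm := capE _ _ eKm.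
have {eK0} eK0 := capE _ _ eK0.
have capF (K' : cone V) (P : V -> Prop) :
    (forall x, cone_set (cone_cap F K') x <-> cone_set F x /\ P x) ->
    (forall x, cone_set F x -> P x) -> cone_cap F K' = F.
  by move=> e h; apply: cone_eq => x; rewrite e; split=> [[]//|Fx]; split=> //; apply: h.
have memP (B : set V) : (F \in meets_relint B) = `[< meets_relint B F >].
  by apply/idP/asboolP => [/set_mem|/mem_set].
have noneg q g : relint F q -> ev g q = 0 ->
    (forall x, cone_set F x -> 0 <= ev g x) -> forall x, cone_set F x -> ev g x = 0.
  move=> [Fq Rq] gq g0 x Fx; have [e e0 /g0] := Rq _ Fx.
  rewrite evB evZ gq sub0r oppr_ge0 pmulr_rle0 // => gx.
  by apply/eqP; rewrite eq_le gx g0.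
rewrite !memP.
have [[y Fy fy]|nopos] := pselect (exists2 y, cone_set F y & 0 < ev f y).
  have [p Rp fp] := relint_pos Fy fy.
  rewrite (asboolT (P := meets_relint [set p | 0 < ev f p] F)); last by exists p.
  have [[z Fz fz]|noneg'] := pselect (exists2 z, cone_set F z & ev f z < 0).
    have [q Rq fq] : exists2 q, relint F q & 0 < ev (- f) q.
      by apply: relint_pos Fz _; rewrite ev_opp oppr_gt0.
    rewrite ev_opp oppr_gt0 in fq.
    rewrite asboolT; last by exists q.
    have B0 : exists2 p, relint F p & ev f p = 0.
      (* A positive combination of [p] and [q] on which the values of [f] cancel. *)
      exists (- ev f q *: p + ev f p *: q).
        apply: relintD; first by apply: relintZ => //; rewrite oppr_gt0.
        by apply: coneZ; [apply: ltW|exact: Rq.1].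
      by rewrite evD !evZ mulNr mulrC addNr.
    rewrite asboolT //.
    have dp : cone_dim (cone_cap F Kp) = cone_dim F.
      rewrite /cone_dim (eq_span Rp (relint_cut eKp Rp fp)) // => x.
      exact: cut_ray eKp Rp.1 fp.
    have eKm' x : cone_set (cone_cap F Km) x <-> cone_set F x /\ 0 <= ev (- f) x.
      by rewrite eKm ev_opp oppr_ge0.
    have fq' : 0 < ev (- f) q by rewrite ev_opp oppr_gt0.
    have dm : cone_dim (cone_cap F Km) = cone_dim F.
      rewrite /cone_dim (eq_span Rq (relint_cut eKm' Rq fq')) // => x.
      exact: cut_ray eKm' Rq.1 fq'.
    have d0 : cone_dim F = (cone_dim (cone_cap F K0)).+1.
      by apply: dim_cut0 eK0 B0 _; exists y; rewrite // gt_eqF.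
    (* The slice has one dimension less than the other three cones, so its class enters with the
       opposite sign. *)
    rewrite /face_term dp dm d0 exprS mulN1r !mulrNz -!mulNrz -!mulrzDl.
    congr (_ *~ _); rewrite -opprD -tpureDl.
    suff <- : cone_class F + cone_class (cone_cap F K0) =
        cone_class (cone_cap F Kp) + cone_class (cone_cap F Km).
      by rewrite tpureDl opprD subrK.
    have -> : cone_cap F K0 = cone_cap (cone_cap F Kp) (cone_cap F Km).
      apply: cone_eq => x; split=> [/eK0[Fx fx]|[/eKp[Fx f1] /eKm[_ f2]]].
        by split; [apply/eKp|apply/eKm]; rewrite fx.
      by apply/eK0; split=> //; apply/eqP; rewrite eq_le f1 f2.
    apply: cone_class_valuation; apply/seteqP; split=> x.
      by move=> Fx; case: (lerP 0 (ev f x)) => fx;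
        [left; apply/eKp|right; apply/eKm; rewrite ltW].
    by case=> [/eKp[]|/eKm[]].
  have f0 x : cone_set F x -> 0 <= ev f x.
    by move=> Fx; rewrite leNgt; apply/negP => fx; apply: noneg'; exists x.
  rewrite !asboolF ?addr0; first by rewrite (capF _ _ eKp).
    by move=> [q Rq fq]; move: fy; rewrite (noneg q f) // ltxx.
  by move=> [q [/f0 + _]] /=; rewrite leNgt => /negP.
have f0 x : cone_set F x -> ev f x <= 0.
  by move=> Fx; rewrite leNgt; apply/negP => fx; apply: nopos; exists x.
rewrite asboolF ?add0r; last by move=> [q [/f0 + _]] /=; rewrite leNgt => /negP.
have [[z Fz fz]|noneg'] := pselect (exists2 z, cone_set F z & ev f z < 0).
  have [q Rq fq] : exists2 q, relint F q & 0 < ev (- f) q.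
    by apply: relint_pos Fz _; rewrite ev_opp oppr_gt0.
  rewrite ev_opp oppr_gt0 in fq.
  rewrite asboolT; last by exists q.
  rewrite asboolF ?addr0; first by rewrite (capF _ _ eKm).
  move=> [q' Rq' fq']; have := noneg q' (- f) Rq'.
  rewrite ev_opp fq' oppr0 => /(_ erefl) h.
  have : ev (- f) z = 0 by apply: h => // x Fx; rewrite ev_opp oppr_ge0 f0.
  by rewrite ev_opp => /eqP; rewrite oppr_eq0 lt_eqF.
have f00 x : cone_set F x -> ev f x = 0.
  move=> Fx; apply/eqP; rewrite eq_le f0 // leNgt; apply/negP => fx.
  by apply: noneg'; exists x.
rewrite asboolF ?add0r; last by move=> [q [/f00 + _]] /= => ->; rewrite ltxx.
rewrite asboolT ?(capF _ _ eK0) //.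
by have [p Rp] := relint_exists F; exists p => //; apply: f00 Rp.1.
Qed.

(** Both sums on the right split by [sum_halfspace], so each face of [K0] occurs twice. Additivity
    at these faces trades the two tangent cones for those in [K] and [K0]; the terms for [K] are
    reindexed over faces of [K] and matched one by one. *)
Lemma sum_cut (A : zmodType) (phi : cone V -> cone V -> A) K f Kp Km K0 :
  (forall x, cone_set Kp x <-> cone_set K x /\ 0 <= ev f x) ->
  (forall x, cone_set Km x <-> cone_set K x /\ ev f x <= 0) ->
  (forall x, cone_set K0 x <-> cone_set K x /\ ev f x = 0) ->
  (forall G, extreme K0 G -> phi G (tangent Kp G) + phi G (tangent Km G) =
    phi G (tangent K G) + phi G (tangent K0 G)) ->
  (forall F T, extreme K F -> phi F T =
    (if F \in meets_relint [set p | 0 < ev f p] then phi (cone_cap F Kp) T else 0) +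
    (if F \in meets_relint [set p | ev f p < 0] then phi (cone_cap F Km) T else 0) +
    (if F \in meets_relint [set p | ev f p = 0] then phi (cone_cap F K0) T else 0)) ->
  \sum_(F \in faces K) phi F (tangent K F) +
    \sum_(F \in faces K0) phi F (tangent K0 F) =
  \sum_(F \in faces Kp) phi F (tangent Kp F) +
    \sum_(F \in faces Km) phi F (tangent Km F).
Proof.
move=> eKp eKm eK0 tangent_cut face_cut.
have eKm' x : cone_set Km x <-> cone_set K x /\ 0 <= ev (- f) x.
  by rewrite eKm ev_opp oppr_ge0.
have eK0' x : cone_set K0 x <-> cone_set K x /\ ev (- f) x = 0.
  rewrite eK0 ev_opp; split=> -[Kx /eqP]; rewrite ?oppr_eq0 => /eqP fx; split=> //.
  by rewrite fx oppr0.
have fin := @finite_faces R V.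
have capR F p : extreme K F -> relint F p -> [set p | ev f p = 0] p ->
    relint (cone_cap F K0) p.
  move=> [FK _]; apply: relint_cut0 => y.
  by split=> [[Fy /eK0[]]//|[Fy fy]]; split=> //; apply/eK0; split=> //; apply: FK.
have K0K x : cone_set K0 x -> cone_set K x by move=> /eK0[].
rewrite (sum_halfspace phi eKp eK0) (sum_halfspace phi eKm' eK0') addrACA.
rewrite -[X in _ = _ + X]fsbig_split; last exact: fin.
have -> : \sum_(G \in faces K0) (phi G (tangent Kp G) + phi G (tangent Km G)) =
    \sum_(G \in faces K0) (phi G (tangent K G) + phi G (tangent K0 G)).
  by apply: eq_fsbigr => G /set_mem/facesP; apply: tangent_cut.
rewrite [X in _ = _ + X]fsbig_split; last exact: fin.
rewrite addrA; congr (_ + _).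
(* The restriction changes nothing, since [f] vanishes on [K0]; it gives the sum the form required
   by [slice_sum]. *)
have -> : \sum_(G \in faces K0) phi G (tangent K G) =
    \sum_(G \in faces K0 `&` meets_relint [set p | ev f p = 0]) phi G (tangent K G).
  apply: eq_fsbigl; apply/seteqP; split=> G; last by case.
  move=> fG; split=> //; have [GK0 _] := (facesP _ _).1 fG.
  have [p Rp] := relint_exists G; have [_ fp] := (eK0 _).1 (GK0 _ Rp.1).
  by exists p.
rewrite (slice_sum (fun G => phi G (tangent K G)) K0K capR).
rewrite !fsbig_mkcondr.
rewrite -[X in _ = X + _]fsbig_split; last exact: fin.
rewrite -[RHS]fsbig_split; last exact: fin.
apply: eq_fsbigr => F /set_mem/facesP eF.
rewrite (face_cut _ _ eF); congr (_ + _ + _).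
  congr (if _ then _ else _); congr (_ \in meets_relint _).
  by apply/seteqP; split=> x; rewrite /= ev_opp oppr_gt0.
case: ifP => // /set_mem[p Rp fp]; congr (phi _ _).
apply: (tangent_eq eF.1 Rp _ (capR _ _ eF Rp fp)) => // y [Fy _].
exact: eF.1.
Qed.

Lemma Delta_valuation : valuation (@Delta R V).
Proof.
apply: cut_valuation_valuation => K f.
set Kp := cone_cap K (halfspace f); set Km := cone_cap K _.
set K0 := cone_cap Kp Km.
have eKp x : cone_set Kp x <-> cone_set K x /\ 0 <= ev f x by [].
have eKm x : cone_set Km x <-> cone_set K x /\ ev f x <= 0.
  by split=> -[Kx fx]; split=> //; move: fx; rewrite halfspaceN.
have eK0 x : cone_set K0 x <-> cone_set K x /\ ev f x = 0.
  split=> [[[Kx f1] /eKm[_ f2]]|[Kx fx]].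
    by split=> //; apply/eqP; rewrite eq_le f2.
  by split; [apply/eKp|apply/eKm]; rewrite fx.
rewrite !DeltaE; apply: (sum_cut eKp eKm eK0) => [G [GK0 _]|F T].
  rewrite /face_term -!mulrzDl -!tpureDr; congr (_ *t _ *~ _).
  have [p Rp] := relint_exists G; have [_ fp] := (eK0 _).1 (GK0 _ Rp.1).
  have TE (K' : cone V) : (forall x, cone_set K0 x -> cone_set K' x) -> forall x,
      cone_set (tangent K' G) x <-> exists2 t : R, 0 <= t & cone_set K' (x + t *: p).
    by move=> s x; apply: tangentP => // y /GK0/s.
  (* Moving along [p] does not change [f], so the tangent cones at [G] are cut by [f] just as [K]
     is. *)
  have fE x t : ev f (x + t *: p) = ev f x by rewrite evD evZ fp mulr0 addr0.
  have TKp := TE Kp _; have {}TKp := TKp (fun x h => h.1).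
  have TKm := TE Km _; have {}TKm := TKm (fun x h => h.2).
  have TK := TE K _; have {}TK := TK (fun x h => h.1.1).
  have TK0 := TE K0 (fun x h => h).
  rewrite -(@cone_class_valuation _ _ _ _ (tangent K G)); last first.
    apply/seteqP; split=> x.
      move=> /TK[t t0 Kt]; case: (lerP 0 (ev f x)) => fx.
        by left; apply/TKp; exists t => //; apply/eKp; rewrite fE.
      by right; apply/TKm; exists t => //; apply/eKm; rewrite fE ltW.
    by case=> [/TKp[t t0 [Kt _]]|/TKm[t t0 [Kt _]]]; apply/TK; exists t.
  congr (_ + cone_class _); apply: cone_eq => x; split; last first.
    move=> /TK0[t t0 [hp hm]].
    by split; [apply/TKp|apply/TKm]; exists t.
  move=> [/TKp[t t0 /eKp[Kt]] + /TKm[u u0 /eKm[_]]]; rewrite !fE => f1 f2.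
  apply/TK0; exists t => //; apply/eK0; split=> //.
  by rewrite fE; apply/eqP; rewrite eq_le f1 f2.
exact: (face_cut T eKp eKm eK0).
Qed.

End HyperplaneCut.

(** * Subspace criteria and the valuation property of [epsilon] *)

Section Counit.
Variables (R : realType) (V : vectType R).
Implicit Types (K F G H : cone V) (f : 'Hom(V, R^o)) (x y p : V).

(** When 0 is a relative interior point, [mem_cone_span] at 0 identifies the cone with its span. *)
Lemma subspace_relint0 K : is_subspace K <-> relint K 0.
Proof.
split=> [[U ->]|R0].
  split=> [|x xU]; first exact: mem0v.
  by exists 1 => //; rewrite scale1r sub0r /= memvN.
exists (cone_span K); apply: cone_eq => x; split=> [Kx|/(mem_cone_span _ R0).1[t _]].
  by apply/(mem_cone_span _ R0); exists 0; rewrite // scaler0 addr0.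
by rewrite scaler0 addr0.
Qed.

Lemma subspaceP K : is_subspace K <-> forall x, cone_set K x -> cone_set K (- x).
Proof.
rewrite subspace_relint0; split=> [[_ h] x /h[e e0]|h].
  by rewrite sub0r -scalerN => /(cone_unscale e0).
split=> [|x /h Kx]; first exact: cone0.
by exists 1 => //; rewrite scale1r sub0r.
Qed.

Lemma epsilon_subspace K : is_subspace K -> epsilon K = (-1) ^+ cone_dim K.
Proof. by move=> h; rewrite /epsilon asboolT. Qed.

Lemma epsilon_eq0 K : ~ is_subspace K -> epsilon K = 0.
Proof. by move=> h; rewrite /epsilon asboolF. Qed.

(** If [f] does not change sign on [K], the cut is trivial. Otherwise [Kp] and [Km] are not
    subspaces, while [K] is one exactly when [K0] is, and their dimensions differ by one. *)
Lemma epsilon_valuation : valuation (@epsilon R V).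
Proof.
apply: cut_valuation_valuation => K f.
set Kp := cone_cap K (halfspace f); set Km := cone_cap K _.
set K0 := cone_cap Kp Km.
have KmE x : cone_set Km x <-> cone_set K x /\ ev f x <= 0.
  by split=> -[Kx fx]; split=> //; move: fx; rewrite halfspaceN.
have K0E x : cone_set K0 x <-> cone_set K x /\ ev f x = 0.
  split=> [[[Kx f1] /KmE[_ f2]]|[Kx fx]].
    by split=> //; apply/eqP; rewrite eq_le f2.
  by split; [split=> //=|apply/KmE]; rewrite fx.
have [[y Ky fy]|npos] := pselect (exists2 y, cone_set K y & 0 < ev f y); last first.
  have eKm : Km = K.
    apply: cone_eq => x; rewrite KmE; split=> [[]//|Kx]; split=> //.
    by rewrite leNgt; apply/negP => fx; apply: npos; exists x.
  have -> : K0 = Kp by apply: cone_eq => x; rewrite /K0 eKm; split=> [[]//|[Kx fx]].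
  by rewrite eKm addrC.
have [[z Kz fz]|nneg] := pselect (exists2 z, cone_set K z & ev f z < 0); last first.
  have eKp : Kp = K.
    apply: cone_eq => x; split=> [[]//|Kx]; split=> //=.
    by rewrite leNgt; apply/negP => fx; apply: nneg; exists x.
  have -> : K0 = Km by apply: cone_eq => x; rewrite /K0 eKp; split=> [[]//|[Kx fx]].
  by rewrite eKp.
rewrite [epsilon Kp]epsilon_eq0 => [|/subspaceP h]; last first.
  have [|_ /=] := h y; first by split=> //; apply: ltW.
  by rewrite evN oppr_ge0 leNgt fy.
rewrite [epsilon Km]epsilon_eq0 ?addr0 => [|/subspaceP h]; last first.
  have /KmE[_] : cone_set Km (- z) by apply: h; apply/KmE; rewrite ltW.
  by rewrite evN oppr_le0 leNgt fz.
have [sK|nK] := pselect (is_subspace K); last first.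
  rewrite !epsilon_eq0 ?addr0 // => /subspaceP h; apply: nK; apply/subspaceP => x Kx.
  (* If [K0] is a subspace, [- x] lies in [K] as the sum of [- (x + w)] and [w]. *)
  suff [w Kw fw] : exists2 w, cone_set K w & ev f (x + w) = 0.
    have /K0E[Kxw _] : cone_set K0 (- (x + w)).
      by apply: h; apply/K0E; split=> //; apply: coneD.
    by rewrite -[- x](subrK w) -opprD; apply: coneD.
  have [fx|fx] := lerP 0 (ev f x).
    exists ((- ev f x / ev f z) *: z); last by rewrite evD evZ divfK ?subrr // lt_eqF.
    by apply: coneZ => //; rewrite mulNr oppr_ge0 mulr_ge0_le0 // invr_le0 ltW.
  exists ((- ev f x / ev f y) *: y); last by rewrite evD evZ divfK ?subrr // gt_eqF.
  by apply: coneZ => //; rewrite divr_ge0 ?oppr_ge0 ?ltW.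
have sK0 : is_subspace K0.
  apply/subspaceP => x /K0E[Kx fx]; apply/K0E; rewrite evN fx oppr0.
  by split=> //; apply: (subspaceP K).1.
rewrite !epsilon_subspace // (dim_cut0 K0E) ?exprS ?mulN1r ?addNr //.
  by exists 0; [apply/subspace_relint0|rewrite ev0].
by exists y; rewrite // gt_eqF.
Qed.

Lemma tangent_relint0 K F : extreme K F -> relint F 0 -> tangent K F = K.
Proof.
move=> eF R0; apply: cone_eq => x; rewrite (tangentP x eF.1 R0).
split=> [[t _]|Kx]; first by rewrite scaler0 addr0.
by exists 0; rewrite // scaler0 addr0.
Qed.

Lemma memv_cone_span F x : cone_set F x -> x \in cone_span F.
Proof. by apply: (cone_spanP F (cone_span F)).1; apply: subvv. Qed.

Lemma cone_spanS F F' : (forall x, cone_set F x -> cone_set F' x) ->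
  (cone_span F <= cone_span F')%VS.
Proof. by move=> s; apply/cone_spanP => x /s; apply: memv_cone_span. Qed.

Lemma sub_tangent K F x : cone_set K x -> cone_set (tangent K F) x.
Proof. by move=> Kx; exists 0, x; rewrite add0r; split=> //; apply: mem0v. Qed.

Lemma span_sub_tangent K F x : x \in cone_span F -> cone_set (tangent K F) x.
Proof. by move=> Fx; exists x, 0; rewrite addr0; split=> //; apply: cone0. Qed.

Lemma cone_span_vs_cone (U : {vspace V}) : cone_span (vs_cone U) = U.
Proof.
apply/eqP; rewrite eqEsubv; apply/andP; split; first exact/cone_spanP.
by apply/subvP => x xU; apply: memv_cone_span.
Qed.

Lemma tangent_self K : tangent K K = vs_cone (cone_span K).
Proof.
apply: cone_eq => x; split=> [[u [k [/= uK Kk ->]]]|]; last exact: span_sub_tangent.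
by apply: memvD => //; apply: memv_cone_span.
Qed.

(** If [- x] is tangent, some [- x + t *: p] lies in [K]; adding [x] gives [t *: p] in [F], so [x]
    is in [F]. *)
Lemma tangent_subspace K F : extreme K F -> is_subspace (tangent K F) -> F = K.
Proof.
move=> [FK eF] /subspaceP h; have [p Rp] := relint_exists F.
apply: cone_eq => x; split=> [/FK//|Kx].
have [t t0 Kt] := (tangentP _ FK Rp).1 (h _ (sub_tangent F Kx)).
by apply: eF Kx Kt _; rewrite addrA subrr add0r; apply: coneZ => //; exact: Rp.1.
Qed.

End Counit.

(** * Flags of faces, coassociativity and the counit identities *)

Section Coassociativity.
Variables (R : realType) (V : vectType R).
Implicit Types (K F G H : cone V) (x y p : V).

Lemma extreme_refl K : extreme K K.
Proof. by []. Qed.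

Lemma extreme_trans K F G : extreme K F -> extreme F G -> extreme K G.
Proof.
move=> [FK eF] [GF eG]; split=> [x /GF/FK//|x y Kx Ky Gxy].
have Fxy := GF _ Gxy; apply: eG Gxy; first exact: eF Fxy.
by apply: (eF y x) => //; rewrite addrC.
Qed.

Lemma extreme_sub K F G : (forall x, cone_set F x -> cone_set K x) ->
  (forall x, cone_set G x -> cone_set F x) -> extreme K G -> extreme F G.
Proof. by move=> FK GF [_ eG]; split=> // x y /FK Kx /FK Ky; apply: eG. Qed.

Lemma cone_span_tangent F G : (forall x, cone_set G x -> cone_set F x) ->
  cone_span (tangent F G) = cone_span F.
Proof.
move=> GF; apply/eqP; rewrite eqEsubv; apply/andP; split; last first.
  by apply: cone_spanS => x; apply: sub_tangent.
apply/cone_spanP => x [u [k [/= uG Fk ->]]].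
apply: memvD; last exact: memv_cone_span.
by apply: (subvP (cone_spanS GF)).
Qed.

(** The span of [F] absorbs the span of [G]. *)
Lemma tangent_tangent K F G : (forall x, cone_set G x -> cone_set F x) ->
  tangent (tangent K G) (tangent F G) = tangent K F.
Proof.
move=> GF; rewrite {1}/tangent (cone_span_tangent GF); apply: cone_eq => x; split.
  move=> [u [_ [/= uF [v [k [/= vG Kk ->]]] ->]]].
  exists (u + v), k; split=> //=; last by rewrite addrA.
  by apply: memvD => //; apply: (subvP (cone_spanS GF)).
move=> [u [k [/= uF Kk ->]]]; exists u, k; split=> //.
exact: sub_tangent.
Qed.

(** The inverse sends [H] to [cone_cap H K]. *)
Lemma faces_tangent K G : extreme K G ->
  set_bij (faces K `&` [set F | faces F G]) (faces (tangent K G))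
    (fun F => tangent F G).
Proof.
move=> eG; have [GK _] := eG; have [p Rp] := relint_exists G; have [Gp _] := Rp.
split.
- move=> F [/facesP[FK eF] /facesP[GF _]]; apply/facesP.
  split=> [x /(tangentP _ GF Rp).1[t t0 /FK Kt]|x y].
    by apply/(tangentP _ GK Rp); exists t.
  move=> /(tangentP _ GK Rp).1[t t0 Kt] /(tangentP _ GK Rp).1[s s0 Ks].
  move=> /(tangentP _ GF Rp).1[r r0 Fr]; apply/(tangentP _ GF Rp).
  exists (t + r); first exact: addr_ge0.
  (* The sum of [x + (t + r) *: p] and [y + s *: p] is a point of [F] plus a multiple of [p], so the
     face property of [F] applies. *)
  apply: (eF _ (y + s *: p)) => //.
    by rewrite scalerDl addrA; apply: coneD => //; apply/coneZ/GK.
  have -> : x + (t + r) *: p + (y + s *: p) = (x + y + r *: p) + (t + s) *: p.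
    by rewrite addrACA -scalerDl -[RHS]addrA -scalerDl addrCA addrA.
  by apply: coneD => //; apply: coneZ; [apply: addr_ge0|apply: GF].
- have sub F F' : faces K F -> faces F G -> faces K F' -> faces F' G ->
      tangent F G = tangent F' G -> forall x, cone_set F x -> cone_set F' x.
    move=> /facesP[FK _] /facesP[GF _] /facesP[_ eF'] /facesP[GF' _] e x Fx.
    have := sub_tangent G Fx; rewrite e => /(tangentP _ GF' Rp).1[t t0 Ft].
    by apply: eF' Ft; [apply: FK|apply/coneZ/GK].
  move=> F F' /set_mem[fF fG] /set_mem[fF' fG'] e.
  by apply: cone_eq => x; split; apply: sub.
- move=> H /facesP[HT eH].
  have GspanH x : x \in cone_span G -> cone_set H x.
    (* [x] and [- x] both lie in the tangent cone, and their sum 0 lies in [H]. *)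
    move=> xG; apply: (eH x (- x)); try by apply: span_sub_tangent; rewrite ?memvN.
    by rewrite subrr; apply: cone0.
  have GH x : cone_set G x -> cone_set (cone_cap H K) x.
    by move=> Gx; split; [apply/GspanH/memv_cone_span|apply: GK].
  have eF : extreme K (cone_cap H K) 
    by apply: (extreme_cap _ (conj HT eH)) => x; apply: sub_tangent.
  exists (cone_cap H K).
    by split; apply/facesP => //; apply: extreme_sub eF.1 GH eG.
  apply: cone_eq => x; rewrite (tangentP _ GH Rp); split=> [[t t0 [Ht _]]|Hx].
    rewrite -(addrK (t *: p) x); apply: coneD => //; apply: GspanH.
    by rewrite memvN memvZ // memv_cone_span.
  have [t t0 Kt] := (tangentP _ GK Rp).1 (HT _ Hx); exists t => //.
  by split=> //; apply: coneD => //; apply: GspanH; rewrite memvZ // memv_cone_span.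
Qed.

(** A face of a face is a face, so [G] may range over all of [faces K] before the summations are
    exchanged. *)
Lemma sum_flags (A : zmodType) K (phi : cone V -> cone V -> A) :
  \sum_(F \in faces K) \sum_(G \in faces F) phi F G =
  \sum_(G \in faces K) \sum_(F \in faces K `&` [set F | faces F G]) phi F G.
Proof.
have -> : \sum_(F \in faces K) \sum_(G \in faces F) phi F G =
    \sum_(F \in faces K) \sum_(G \in faces K) if G \in faces F then phi F G else 0.
  apply: eq_fsbigr => F /set_mem/facesP eF; rewrite -fsbig_mkcondr.
  apply: eq_fsbigl; apply/seteqP; split=> [G fG|G []//]; split=> //.
  by move/facesP: fG => eG; apply/facesP; apply: extreme_trans eF eG.
rewrite exchange_fsbig; try exact: finite_faces.
by apply: eq_fsbigr => G _; rewrite fsbig_mkcondr.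
Qed.

Lemma raddf_fsum (A B : zmodType) (g : {additive A -> B}) (I : choiceType)
    (P : set I) (F : I -> A) : finite_set P ->
  g (\sum_(i \in P) F i) = \sum_(i \in P) g (F i).
Proof. by move=> fP; rewrite !fsbig_finite // raddf_sum. Qed.

Lemma tpure_fsuml (A B : zmodType) (I : choiceType) (P : set I) (F : I -> A) (b : B) :
  finite_set P -> (\sum_(i \in P) F i) *t b = \sum_(i \in P) (F i *t b).
Proof.
move=> fP; rewrite !fsbig_finite //.
by apply: (big_morph (fun a => a *t b)) => [x y|]; rewrite ?tpureDl ?tpure0l.
Qed.

Lemma tpure_fsumr (A B : zmodType) (I : choiceType) (P : set I) (a : A) (F : I -> B) :
  finite_set P -> a *t (\sum_(i \in P) F i) = \sum_(i \in P) (a *t F i).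
Proof.
move=> fP; rewrite !fsbig_finite //.
by apply: (big_morph (fun b => a *t b)) => [x y|]; rewrite ?tpureDr ?tpure0r.
Qed.

Lemma mulz_fsum (A : zmodType) (I : choiceType) (P : set I) (F : I -> A) (n : int) :
  finite_set P -> (\sum_(i \in P) F i) *~ n = \sum_(i \in P) (F i *~ n).
Proof.
move=> fP; rewrite !fsbig_finite //.
by apply: (big_morph (fun a => a *~ n)) => [x y|]; rewrite ?mulrzDl ?mul0rz.
Qed.

Lemma mulr_sign2 (A : zmodType) (a : A) n : a *~ ((-1) ^+ n) *~ ((-1) ^+ n) = a.
Proof. by rewrite -mulrzA -expr2 sqrr_sign. Qed.

Definition additive_Delta : {additive cone_group V -> tensor _ _} :=
  induced (@Delta_valuation R V).

Definition additive_epsilon : {additive cone_group V -> int} :=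
  induced (@epsilon_valuation R V).

(** Both sides become sums over flags [G], [F] of faces of [K]. On the right, [faces_tangent]
    parametrises the faces of the tangent cone at [G] by such [F], with the same tensor factors and
    signs. *)
Lemma coassociative_class K :
  tassoc (tmap additive_Delta idfun (Delta K)) = tmap idfun additive_Delta (Delta K).
Proof.
have fin := @finite_faces R V.
rewrite DeltaE !(raddf_fsum _ _ (fin K)).
transitivity (\sum_(F \in faces K) \sum_(G \in faces F)
   ((cone_class G *t (cone_class (tangent F G) *t cone_class (tangent K F)))
      *~ ((-1) ^+ cone_dim G)) *~ ((-1) ^+ cone_dim F)).
  apply: eq_fsbigr => F _; rewrite /face_term !raddfMz /= tmap_pure /=.
  rewrite induced_class DeltaE tpure_fsuml // raddf_fsum // mulz_fsum //.
  apply: eq_fsbigr => G _; congr (_ *~ _).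
  by rewrite /face_term tpure_mulz_l raddfMz /= tassoc_pure.
rewrite sum_flags; apply: eq_fsbigr => G /set_mem/facesP eG.
rewrite /face_term raddfMz /= tmap_pure /= induced_class DeltaE.
rewrite tpure_fsumr //.
rewrite mulz_fsum //.
rewrite (reindex_fsbig _ _ _ _ (faces_tangent eG)).
apply: eq_fsbigr => F /set_mem[/facesP eF /facesP[GF _]].
rewrite /face_term tangent_tangent // tpure_mulz_r mulrzAC.
by rewrite {3}/cone_dim cone_span_tangent.
Qed.

(** Only the face [F0] with 0 in its relative interior, the lineality space, is a subspace; its
    tangent cone is [K], and the two signs cancel. *)
Lemma counitl_class K : tunitl (tmap additive_epsilon idfun (Delta K)) = cone_class K.
Proof.
have fin := @finite_faces R V.
have [F0 eF0 R0] := face_at (cone0 K).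
rewrite DeltaE !(raddf_fsum _ _ (fin K)).
rewrite (fsbigD1 F0) ?fin //=; last exact/facesP.
rewrite fsbig1 ?addr0 => [|F [/facesP eF nF]].
  rewrite /face_term !raddfMz /= tmap_pure tunitl_pure /= induced_class.
  rewrite (tangent_relint0 eF0 R0) epsilon_subspace ?mulr_sign2 //.
  exact/subspace_relint0.
rewrite /face_term !raddfMz /= tmap_pure tunitl_pure /= induced_class.
rewrite epsilon_eq0 ?mulr0z ?mul0rz // => /subspace_relint0 RF; apply: nF.
exact: extreme_relint_inj eF eF0 RF R0.
Qed.

(** Only [F = K] has a subspace as tangent cone, namely the span of [K], whose dimension supplies
    the cancelling sign. *)
Lemma counitr_class K : tunitr (tmap idfun additive_epsilon (Delta K)) = cone_class K.
Proof.
have fin := @finite_faces R V.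
rewrite DeltaE !(raddf_fsum _ _ (fin K)).
rewrite (fsbigD1 K) ?fin //=; last exact/facesP/extreme_refl.
rewrite fsbig1 ?addr0 => [|F [/facesP eF nF]].
  rewrite /face_term !raddfMz /= tmap_pure tunitr_pure /= induced_class tangent_self.
  rewrite epsilon_subspace; last by eexists.
  by rewrite {1}/cone_dim cone_span_vs_cone mulr_sign2.
rewrite /face_term !raddfMz /= tmap_pure tunitr_pure /= induced_class.
by rewrite epsilon_eq0 ?mulr0z ?mul0rz // => /(tangent_subspace eF).
Qed.

Lemma cone_group_ext (A : zmodType) (g h : {additive cone_group V -> A}) :
  (forall K, g (cone_class K) = h (cone_class K)) -> g =1 h.
Proof. exact: presented_ext. Qed.

End Coassociativity.

Theorem theoremA1p6 (R : realType) (V : vectType R) :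
  exists hD : valuation (@Delta R V),
    let D := induced hD in
    (forall x : cone_group V, tassoc (tmap D idfun (D x)) = tmap idfun D (D x)) /\
    exists he : valuation (@epsilon R V),
      let e := induced he in
      (forall x : cone_group V, tunitl (tmap e idfun (D x)) = x) /\
      (forall x : cone_group V, tunitr (tmap idfun e (D x)) = x).
Proof.
exists (@Delta_valuation R V) => D; split.
  pose g : {additive cone_group V -> _} :=
    @tassoc _ _ _ \o tmap (additive_Delta V) idfun \o additive_Delta V.
  pose h : {additive cone_group V -> _} :=
    tmap idfun (additive_Delta V) \o additive_Delta V.
  apply: (@cone_group_ext _ _ _ g h) => K.
  by rewrite /g /h /= induced_class; apply: coassociative_class.
exists (@epsilon_valuation R V) => e; split.
  pose g : {additive cone_group V -> _} :=
    @tunitl _ \o tmap (additive_epsilon V) idfun \o additive_Delta V.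
  apply: (@cone_group_ext _ _ _ g idfun) => K.
  by rewrite /g /= induced_class; apply: counitl_class.
pose g : {additive cone_group V -> _} :=
  @tunitr _ \o tmap idfun (additive_epsilon V) \o additive_Delta V.
apply: (@cone_group_ext _ _ _ g idfun) => K.
by rewrite /g /= induced_class; apply: counitr_class.
Qed.
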